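(* The set of limit points (in $\mathbb R$) of $T_{\operatorname{graph}}$ is some set $S_{\operatorname{graph}}$ of Pisot numbers. Furthermore, $T_{\operatorname{graph}}\cup S_{\operatorname{graph}}$ is a closed subset of $\mathbb R$.
   Context: Graphs are finite simple graphs; the eigenvalues of a graph are those of its adjacency matrix (all real). A Pisot number is a real algebraic integer $\theta>1$ all of whose other Galois conjugates have modulus $<1$. A Salem number is a real algebraic integer $\tau>1$ whose other conjugates all have modulus $\le 1$, at least one having modulus exactly $1$. A graph $G$ is a Salem graph if either (i) $G$ is nonbipartite, has exactly one eigenvalue $\lambda>2$ and no eigenvalues in $(-\infty,-2)$; or (ii) $G$ is bipartite, has exactly one eigenvalue $\lambda>2$ and only the eigenvalue $-\lambda$ in $(-\infty,-2)$. A Salem graph is trivial if it is nonbipartite and $\lambda\in\mathbb Z$, or bipartite and $\lambda^2\in\mathbb Z$. For a nontrivial Salem graph $G$, $\tau(G)$ is the larger root of $z+1/z=\lambda$ in the nonbipartite case and of $\sqrt z+1/\sqrt z=\lambda$ in the bipartite case (it is a Salem number). $T_{\operatorname{graph}}$ denotes the set of all $\tau(G)$ for $G$ a nontrivial Salem graph. *)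

(* Defs.v *)
From HB Require Import structures.
From mathcomp Require Import all_boot all_order all_algebra.
From mathcomp Require Import complex.
From mathcomp Require Import classical_sets reals topology normedtype.
Import numFieldNormedType.Exports.
Set Implicit Arguments. Unset Strict Implicit. Unset Printing Implicit Defensive.
Import Order.TTheory GRing.Theory Num.Theory.
Local Open Scope ring_scope.
Local Open Scope classical_set_scope.

Section Defs.
Variable R : realType.

Definition min_poly_int (p : {poly int}) (x : R) : Prop :=
  p \is monic /\
  irreducible_poly (map_poly (fun a : int => a%:~R : rat) p) /\
  root (map_poly (fun a : int => a%:~R : R) p) x.

Definition conjugate_of (p : {poly int}) (z : R[i]) : bool :=
  root (map_poly (fun a : int => a%:~R : R[i]) p) z.

Definition pisot (theta : R) : Prop :=
  1 < theta /\ exists p : {poly int}, min_poly_int p theta /\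
    forall z : R[i], conjugate_of p z -> z != (theta%:C)%C -> `|z| < 1.

Definition salem_number (tau : R) : Prop :=
  1 < tau /\ exists p : {poly int}, min_poly_int p tau /\
    (forall z : R[i], conjugate_of p z -> z != (tau%:C)%C -> `|z| <= 1) /\
    (exists z : R[i], [/\ conjugate_of p z, z != (tau%:C)%C & `|z| = 1]).

Definition simple_graph (n : nat) (e : rel 'I_n) : Prop :=
  symmetric e /\ irreflexive e.

Definition adjacency (n : nat) (e : rel 'I_n) : 'M[R]_n :=
  \matrix_(i, j) (e i j)%:R.

Definition charpoly_graph (n : nat) (e : rel 'I_n) : {poly R} :=
  char_poly (adjacency e).

Definition bipartite (n : nat) (e : rel 'I_n) : Prop :=
  exists c : 'I_n -> bool, forall i j, e i j -> c i != c j.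

(* [G] is a Salem graph whose unique eigenvalue > 2 is [lam]. "Exactly one
   eigenvalue > 2" is counted with multiplicity. *)
Definition salem_graph (n : nat) (e : rel 'I_n) (lam : R) : Prop :=
  let p := charpoly_graph e in
  [/\ (2 < lam /\ root p lam), mup lam p = 1%N,
      (forall x, 2 < x -> root p x -> x = lam),
      (~ bipartite e -> forall x, x < -2 -> ~~ root p x) &
      (bipartite e -> root p (- lam) /\ forall x, x < -2 -> root p x -> x = - lam)].

Definition is_integer (x : R) : Prop := exists z : int, x = z%:~R.

Definition trivial_salem_graph (n : nat) (e : rel 'I_n) (lam : R) : Prop :=
  (~ bipartite e /\ is_integer lam) \/ (bipartite e /\ is_integer (lam ^+ 2)).

Definition tau_graph (n : nat) (e : rel 'I_n) (lam tau : R) : Prop :=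
  (~ bipartite e ->
     tau + tau^-1 = lam /\ forall z : R, z + z^-1 = lam -> z <= tau) /\
  (bipartite e ->
     0 <= tau /\ Num.sqrt tau + (Num.sqrt tau)^-1 = lam /\
     forall z : R, 0 <= z -> Num.sqrt z + (Num.sqrt z)^-1 = lam -> z <= tau).

Definition T_graph : set R :=
  [set tau | exists (n : nat) (e : rel 'I_n) (lam : R),
     [/\ simple_graph e, salem_graph e lam, ~ trivial_salem_graph e lam
       & tau_graph e lam tau]].

End Defs.

(* Main.v *)
(** Take Salem graphs whose parameters accumulate at a limit; their degrees are bounded because [lambda] is. Two disjoint non-adjacent subgraphs on which [A - 2] is somewhere positive would give two eigenvalues above 2, and a connected set [S] with [sum_S (deg - 2) >= 3] yields such a subgraph; so a connected Salem graph of bounded degree has boundedly many vertices of degree at least 3. Put these in a core [C], absorb into it every path leaving it that stays short, and pass to a subfamily with one fixed core: adjacency matrix [A] on [c] vertices, diagonal matrix [D] of the numbers of paths leaving each core vertex, and all these paths arbitrarily long.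

With [lambda = sigma + 1/sigma] (so [tau] is [sigma], or [sigma^2] for bipartite graphs), solutions of [A y = (z + 1/z) y] with [|z| > 1] decay like [z^-k] along the paths, so the limit [s] of the [sigma]'s is a root of [det (z^2 + 1 - z A - D)], a monic integer polynomial. A root [z] with [|z| > 1] gives approximate eigenvectors of the finite graphs, forcing [z = s] (or [z = - s] in the bipartite case). If [|z| = 1] and [z] is not real, taking imaginary parts shows that a null vector is killed by [D]; it is then an eigenvector of [A] supported away from the paths. Were such a [z] conjugate to [s], conjugating this vector would make [s + 1/s] an exact eigenvalue of every graph of the family, whereas the [sigma]'s differ from [s]. *)
Require Import Defs.
From HB Require Import structures.
From mathcomp Require Import all_boot all_order all_algebra.
From mathcomp Require Import complex.
From mathcomp Require Import ring lra zify.
From mathcomp Require Import boolp classical_sets reals topology normedtype.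
Import numFieldNormedType.Exports.
Import Order.TTheory GRing.Theory Num.Theory.
Import mathcomp.boot.fintype mathcomp.boot.finset mathcomp.algebra.zmodp.
Set Implicit Arguments. Unset Strict Implicit. Unset Printing Implicit Defensive.

(** * Bounding the number of branch vertices *)

Section Branch.
Variables (n : nat) (e : rel 'I_n).
Hypothesis sym_e : symmetric e.
Implicit Types (X Y S : {set 'I_n}).

Definition deg (u : 'I_n) := #|[set v | e u v]|.
Definition cl X := [set v | (v \in X) || [exists u in X, e v u]].
Definition outer X := cl X :\: X.
Definition excess S := \sum_(v in S) (deg v - 2).

(** Isolated vertices are exempt: passing to a component will delete edges but keep the vertex type
    ['I_n]. *)
Definition connected_graph := forall X, (forall u v, u \in X -> e u v -> v \in X) ->
  forall u v, u \in X -> 0 < deg u -> 0 < deg v -> v \in X.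

Lemma outerP X v : reflect (v \notin X /\ exists2 u, u \in X & e u v) (v \in outer X).
Proof.
rewrite !inE; apply: (iffP andP) => [[vX]|[vX [u uX euv]]].
  by rewrite (negbTE vX) => /exists_inP[u uX euv]; split => //; exists u => //; rewrite sym_e.
by split=> //; apply/orP; right; apply/exists_inP; exists u => //; rewrite sym_e.
Qed.

Lemma sub_cl X : X \subset cl X.
Proof. by apply/subsetP => v vX; rewrite inE vX. Qed.

Lemma cl_adj X u v : u \in X -> e u v -> v \in cl X.
Proof.
by move=> uX uv; rewrite inE; apply/orP; right; apply/exists_inP; exists u => //; rewrite sym_e.
Qed.

(** The vertex [p] leaves the boundary and one of its neighbours already lies in [S], so at most
    [deg p - 1] vertices enter. Absorbing a vertex of degree at least 2 thus raises the boundary by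
    no more than it raises the excess. *)
Lemma card_outerU1 S p : p \in outer S ->
  #|outer (p |: S)| + 2 <= #|outer S| + deg p.
Proof.
move=> /outerP[pS [q qS qp]].
have -> : #|outer S| = (#|outer S :\ p|).+1.
  by rewrite (cardsD1 p (outer S)) (introT (outerP _ _)) //; split=> //; exists q.
have -> : deg p = (#|[set v | e p v] :\ q|).+1.
  by rewrite /deg (cardsD1 q) inE sym_e qp.
suff h : #|outer (p |: S)| <= #|outer S :\ p| + #|[set v | e p v] :\ q| by lia.
apply: leq_trans (leq_card_setU _ _); apply: subset_leq_card; apply/subsetP => v.
move=> /outerP[]; rewrite !inE negb_or => /andP[vp vS] [u].
rewrite !inE => /orP[/eqP ->|uS] uv; last first.
  by rewrite vp (negbTE vS) /=; apply/orP; left; apply/exists_inP; exists u => //; rewrite sym_e.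
by rewrite uv andbT; apply/orP; right; apply: contraNneq vS => ->.
Qed.

Lemma card_outer_le_sum S : #|outer S| <= \sum_(v in S) deg v.
Proof.
have -> : outer S = (\bigcup_(v in S) [set w | e v w]) :\: S.
  apply/setP => w; rewrite [in RHS]inE; apply/outerP/andP => -[wS].
    by case=> v vS vw; split=> //; apply/bigcupP; exists v => //; rewrite inE.
  by move=> /bigcupP[v vS]; rewrite inE => vw; split=> //; exists v.
apply: leq_trans (subset_leq_card (subsetDl _ _)) _.
elim/big_ind2: _ => [|A a B b ha hb|//]; first by rewrite cards0.
exact: leq_trans (leq_card_setU _ _) (leq_add ha hb).
Qed.

Lemma excessU1 S p : p \notin S -> excess (p |: S) = (deg p - 2) + excess S.
Proof. by move=> pS; rewrite /excess big_setU1. Qed.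

Variable d : nat.
Hypothesis deg_le : forall u, deg u <= d.

Lemma card_outer_cl X : #|outer (cl X)| <= d * #|outer X|.
Proof.
have sub : outer (cl X) \subset \bigcup_(v in outer X) [set w | e v w].
  apply/subsetP => w /outerP[wX [u uX uw]]; apply/bigcupP; exists u; last by rewrite inE.
  by rewrite inE uX andbT; apply: contra wX => uX'; apply: cl_adj uw.
apply: leq_trans (subset_leq_card sub) _; rewrite mulnC -sum_nat_const.
elim/big_ind2: _ => [|A a B b ha hb|v _]; first by rewrite cards0.
  exact: leq_trans (leq_card_setU _ _) (leq_add ha hb).
exact: deg_le.
Qed.

Definition deg2 := [set v | 1 < deg v].
Definition branch := [set v | 2 < deg v].

Lemma card_branch_le S : #|branch :&: S| <= excess S.
Proof.
rewrite -sum1_card /excess [X in _ <= X](big_setID branch) /= setIC.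
apply: leq_trans (leq_addr _ _); apply: leq_sum => v.
by rewrite !inE => /andP[_ h]; rewrite subn_gt0.
Qed.

Lemma excess_deg2 S : S \subset deg2 -> \sum_(v in S) deg v = excess S + 2 * #|S|.
Proof.
move=> /subsetP h; rewrite mulnC -sum_nat_const -big_split /=.
by apply: eq_bigr => v /h; rewrite inE => hv; rewrite subnK.
Qed.

Hypothesis conn : connected_graph.
(** The inequality [#|outer S| < 2 * excess S] makes a vector supported on [cl S] negative for the
    form of [2 - A] (see [gform_test_vector]); a single eigenvalue above 2 rules out two such
    vectors that do not interact. *)
Hypothesis no_two_negative : forall S1 S2, S1 \subset deg2 -> S2 \subset deg2 ->
  #|outer S1| < 2 * excess S1 -> #|outer S2| < 2 * excess S2 ->
  (forall u v, u \in cl S1 -> v \in cl S2 -> u != v /\ ~~ e u v) -> False.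

(** A set is grown from one branch vertex by absorbing boundary vertices of degree at least 2, which
    preserves [#|outer S| <= excess S + 2]. Either the excess passes 2, and then
    [excess S + 2 < 2 * excess S], or growth stops at leaves; by connectedness [S] then contains
    every branch vertex, and there are at most [excess S] of them. *)
Lemma negative_set_or_few_branch : #|branch| <= 2 \/
  exists T : {set 'I_n}, [/\ T \subset deg2, 2 < excess T, excess T <= d & #|outer T| <= excess T + 2].
Proof.
have [->|[p0 p0b]] := set_0Vmem branch; first by left; rewrite cards0.
have p0deg : 2 < deg p0 by rewrite inE in p0b.
have out1 : #|outer [set p0]| <= deg p0.
  by apply: leq_trans (card_outer_le_sum _) _; rewrite big_set1.
have ex1 : excess [set p0] = deg p0 - 2 by rewrite /excess big_set1.
have p02 : [set p0] \subset deg2 by rewrite sub1set inE ltnW.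
have [big|small] := ltnP 2 (deg p0 - 2).
  right; exists [set p0]; split; rewrite // ?ex1 //.
    by rewrite (leq_trans (leq_subr _ _)).
  by rewrite subnK // ltnW.
pose F S := [&& p0 \in S, S \subset deg2, #|outer S| <= excess S + 2 & excess S <= 2].
have F1 : F [set p0] by rewrite /F set11 p02 ex1 small subnK ?out1 // ltnW.
case: (arg_maxnP (fun S : {set 'I_n} => #|S|) F1) => S /and4P[pS S2 oS eS] maxS.
have [[p pN p2]|noP] : (exists2 p, p \in outer S & 1 < deg p) \/ (forall p, p \in outer S -> deg p <= 1).
  have [/exists_inP[p ? ?]|] := boolP [exists p in outer S, 1 < deg p]; first by left; exists p.
  by rewrite negb_exists_in => /forall_inP h; right => p /h; rewrite -leqNgt.
  have pS' : p \notin S by case/outerP: pN.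
  have out2 := card_outerU1 pN.
  have ex2 := excessU1 pS'.
  have sub2 : (p |: S) \subset deg2 by rewrite subUset S2 andbT sub1set inE.
  have out3 : #|outer (p |: S)| <= excess (p |: S) + 2 by lia.
  right; exists (p |: S); split => //; last by have := deg_le p; lia.
  rewrite ltnNge; apply/negP => small2.
  have := maxS (p |: S); rewrite /F sub2 out3 small2 !inE pS orbT /= => /(_ isT).
  by rewrite cardsU1 pS' /= add1n ltnn.
left; apply: leq_trans (subset_leq_card _) (leq_trans (card_branch_le S) eS).
apply/subsetP => v vb; rewrite inE vb /=.
have closed u w : u \in cl S -> e u w -> w \in cl S.
  have [uS _ uw|uS ucl uw] := boolP (u \in S); first exact: cl_adj uw.
  have /outerP[_ [q qS qu]] : u \in outer S by rewrite inE uS.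
  have : deg u <= 1 by apply: noP; rewrite inE uS.
  rewrite /deg (cardsD1 q) inE sym_e qu ltnS leqn0 cards_eq0 => /eqP/setP/(_ w).
  rewrite !inE uw andbT => /negbT; rewrite negbK => /eqP ->.
  by rewrite qS.
have vdeg : 2 < deg v by rewrite inE in vb.
have := conn closed (subsetP (sub_cl S) _ pS) (ltnW (ltnW p0deg)) (ltnW (ltnW vdeg)).
move=> vcl; apply/negPn/negP => vS.
have : deg v <= 1 by apply: noP; rewrite inE vS.
by lia.
Qed.

(** Since [T] is negative, no set far from [T] is. Growing one outside a neighbourhood [Y] of [T]
    until it is stuck gives an [S] of bounded excess, and connectedness leaves no vertex of degree
    at least 2 outside [Y] and [S]. *)
Lemma few_branch_of_negative (T : {set 'I_n}) : T \subset deg2 -> 2 < excess T -> excess T <= d ->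
  #|outer T| <= excess T + 2 ->
  #|branch| <= d + (d + 2) * (1 + d + d ^ 2) + 2 * ((d + 2) * d ^ 3).
Proof.
move=> T2 eT eTd oT.
(* Three closures: a set avoiding [Y] has its closed neighbourhood disjoint from and non-adjacent to
   that of [T]. *)
have [Y YE] : exists Y, Y = cl (cl (cl T)) by exists (cl (cl (cl T))).
pose Z := outer Y :&: deg2.
have TY : T \subset Y.
  by rewrite YE; exact: subset_trans (sub_cl _) (subset_trans (sub_cl _) (sub_cl _)).
have o1 : #|outer T| <= d + 2 by lia.
have o2 : #|outer (cl T)| <= (d + 2) * d.
  by rewrite (leq_trans (card_outer_cl _)) // mulnC leq_mul2r o1 orbT.
have o3 : #|outer (cl (cl T))| <= (d + 2) * d ^ 2.
  by rewrite (leq_trans (card_outer_cl _)) // mulnC expnSr mulnA leq_mul2r o2 orbT.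
have o4 : #|outer Y| <= (d + 2) * d ^ 3.
  by rewrite YE (leq_trans (card_outer_cl _)) // mulnC expnSr mulnA leq_mul2r o3 orbT.
(* The seeds [Z] may lie in many pieces, so the growth starts from the degree sum of [Z], which is
   [excess Z + 2 * #|Z|]; hence [2 * #|Z|] in place of the constant 2. *)
pose F S := [&& Z \subset S, S \subset deg2, [disjoint S & Y] & #|outer S| <= excess S + 2 * #|Z|].
have FZ : F Z.
  rewrite /F subxx subsetIr /= -excess_deg2 ?subsetIr // card_outer_le_sum andbT.
  by rewrite disjoint_subset; apply/subsetP => v /setIP[/setDP[_ vY] _]; rewrite inE.
case: (arg_maxnP (fun S : {set 'I_n} => #|S|) FZ) => S /and4P[ZS S2 SY oS] maxS.
have SYn v : v \in S -> v \notin Y by move=> vS; rewrite (disjointFr SY).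
have noP p : p \in outer S -> 1 < deg p -> p \in Y.
  move=> pN p2; apply/negPn/negP => pY.
  have pS' : p \notin S by case/outerP: pN.
  have out2 := card_outerU1 pN.
  have ex2 := excessU1 pS'.
  have := maxS (p |: S); rewrite /F.
  have -> : Z \subset p |: S by rewrite (subset_trans ZS) // subsetUr.
  have -> : p |: S \subset deg2 by rewrite subUset S2 andbT sub1set inE.
  have -> : [disjoint p |: S & Y].
    by rewrite disjoint_subset; apply/subsetP => v /setU1P[->|/SYn]; rewrite inE.
  have -> : #|outer (p |: S)| <= excess (p |: S) + 2 * #|Z| by lia.
  by move=> /(_ isT); rewrite cardsU1 pS' /= add1n ltnn.
have eS : excess S <= 2 * #|Z|.
  have : ~ (#|outer S| < 2 * excess S); last by lia.
  move=> negS; apply: (no_two_negative T2 S2 _ negS); first by lia.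
  move=> u v uT vS; apply/andP; rewrite -negb_or; apply/negP => uv.
  have v2 : v \in cl (cl T).
    by case/orP: uv => [/eqP <-|uv]; [exact: (subsetP (sub_cl _)) | exact: cl_adj uv].
  have [vS'|vS'] := boolP (v \in S).
    by move/negP: (SYn v vS'); apply; rewrite YE; exact: (subsetP (sub_cl _)).
  have /outerP[_ [s sS sv]] : v \in outer S by rewrite inE vS'.
  by move/negP: (SYn s sS); apply; rewrite YE; apply: cl_adj v2 _; rewrite sym_e.
(* Otherwise the boundary of the leftover set [W] consists of leaves, so [cl W] is closed under
   adjacency and misses [T], against connectedness. *)
have cover : deg2 \subset Y :|: S.
  apply/subsetP => w0 w02; apply/negPn/negP => w0n.
  pose W := deg2 :\: (Y :|: S).
  have w0W : w0 \in W by rewrite inE w0n.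
  have leafW v : v \in outer W -> deg v <= 1.
    move=> /outerP[vW [w wW wv]]; rewrite leqNgt; apply/negP => v2.
    move: wW; rewrite !inE negb_or => /andP[/andP[wY wS] w2].
    move: vW; rewrite !inE v2 andbT negbK => /orP[vY|vS].
      move/negP: wS; apply; apply: (subsetP ZS); rewrite inE [w \in deg2]inE w2 andbT.
      by apply/outerP; split => //; exists v => //; rewrite sym_e.
    move/negP: wY; apply; apply: noP => //.
    by apply/outerP; split => //; exists v => //; rewrite sym_e.
  have closed u w : u \in cl W -> e u w -> w \in cl W.
    have [uS _ uw|uS ucl uw] := boolP (u \in W); first exact: cl_adj uw.
    have uo : u \in outer W by rewrite inE uS.
    have /outerP[_ [q qS qu]] := uo.
    have := leafW _ uo.
    rewrite /deg (cardsD1 q) inE sym_e qu ltnS leqn0 cards_eq0 => /eqP/setP/(_ w).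
    rewrite !inE uw andbT => /negbT; rewrite negbK => /eqP ->.
    by move: qS; rewrite !inE => ->.
  have [t tT] : exists t, t \in T.
    have [T0|[t tT]] := set_0Vmem T; last by exists t.
    by move: eT; rewrite /excess T0 big_set0.
  have t2 : 1 < deg t by have := subsetP T2 t tT; rewrite inE.
  have w02' : 1 < deg w0 by rewrite inE in w02.
  have := conn closed (subsetP (sub_cl _) _ w0W) (ltnW w02') (ltnW t2).
  move=> tcl.
  have tW : t \notin W by rewrite !inE (subsetP TY _ tT).
  have : deg t <= 1 by apply: leafW; rewrite inE tW.
  by rewrite leqNgt t2.
have sub : branch \subset (branch :&: T) :|: (outer T :|: (outer (cl T) :|: outer (cl (cl T)))) :|: (branch :&: S).
  apply/subsetP => v vb.
  have v2 : v \in deg2 by move: vb; rewrite !inE => /ltnW.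
  rewrite !in_setU !in_setI vb /= !in_setD.
  have := subsetP cover v v2; rewrite in_setU YE.
  case: (v \in T) => //; case: (v \in cl T); rewrite ?orbT //=.
  case: (v \in cl (cl T)); rewrite ?orbT //=.
apply: leq_trans (subset_leq_card sub) _.
apply: leq_trans (leq_card_setU _ _) _.
have c1 := card_branch_le T; have c2 := card_branch_le S.
have [c3 _] := leq_card_setU (branch :&: T) (outer T :|: (outer (cl T) :|: outer (cl (cl T)))).
have [c4 _] := leq_card_setU (outer T) (outer (cl T) :|: outer (cl (cl T))).
have [c5 _] := leq_card_setU (outer (cl T)) (outer (cl (cl T))).
have c6 : #|Z| <= #|outer Y| by apply: subset_leq_card; exact: subsetIl.
have -> : (d + 2) * (1 + d + d ^ 2) = (d + 2) + (d + 2) * d + (d + 2) * d ^ 2 by rewrite !mulnDr muln1.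
move: o2 o3 o4.
move: ((d + 2) * d) ((d + 2) * d ^ 2) ((d + 2) * d ^ 3) => x2 x3 x4 o2 o3 o4.
have h1 := leq_trans c3 (leq_add (leq_trans c1 eTd) (leq_trans c4 (leq_add o1 (leq_trans c5 (leq_add o2 o3))))).
have h2 : excess S <= 2 * x4 by rewrite (leq_trans eS) // leq_mul2l (leq_trans c6).
apply: leq_trans (leq_add h1 (leq_trans c2 h2)) _.
by rewrite !addnA.
Qed.

Lemma card_branch_bounded :
  #|branch| <= 2 + (d + (d + 2) * (1 + d + d ^ 2) + 2 * ((d + 2) * d ^ 3)).
Proof.
have [h|[T [T2 e1 e2 oT]]] := negative_set_or_few_branch; first exact: leq_trans h (leq_addr _ _).
exact: leq_trans (few_branch_of_negative T2 e1 e2 oT) (leq_addl _ _).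
Qed.
End Branch.

Local Open Scope ring_scope.

(** * Conjugates of algebraic integers *)

Definition intp (K : numFieldType) (p : {poly int}) : {poly K} :=
  map_poly (fun a : int => a%:~R : K) p.

Lemma intp_ratr (K : numFieldType) (p : {poly int}) :
  intp K p = map_poly (ratr : rat -> K) (intp rat p).
Proof. by apply/polyP => i; rewrite !coef_map /= ratr_int. Qed.

(** An irreducible [p] that does not divide [q] is coprime to it, and a Bezout relation persists in
    [K], against the common root. Two fields are needed to compare a real number with its complex
    conjugates. *)
Lemma irreducible_common_root (K L : numFieldType) (p q : {poly int})
    (x : K) (z : L) :
  irreducible_poly (intp rat p) -> root (intp K p) x -> root (intp L p) z ->
  root (intp K q) x -> root (intp L q) z.
Proof.
rewrite !(intp_ratr K) !(intp_ratr L).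
move: (intp rat p) (intp rat q) => P Q irr px pz qx.
have [dv|] := boolP (P %| Q).
  have /dvdpP [r ->] := dv.
  by rewrite rmorphM rootM pz orbT.
rewrite -(@irreducible_poly_coprime _ P Q irr) => cop.
have copK : coprimep (map_poly (ratr : rat -> K) P) (map_poly (ratr : rat -> K) Q).
  by rewrite coprimep_map.
by have := coprimep_root copK px; rewrite -rootE qx.
Qed.

Lemma size_intp (K : numFieldType) (p : {poly int}) : size (intp K p) = size p.
Proof. by apply: size_map_inj_poly; [exact: intr_inj|]. Qed.

Lemma intpM (K : numFieldType) (p q : {poly int}) :
  intp K (p * q) = intp K p * intp K q.
Proof. exact: (rmorphM (map_poly (intr : int -> K))). Qed.

Lemma intp_char_poly (K : numFieldType) n (M : 'M[int]_n) :
  intp K (char_poly M) = char_poly (map_mx intr M).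
Proof. exact: (map_char_poly (intr : {rmorphism int -> K})). Qed.

Lemma unit_lead_monic (K : numFieldType) (p : {poly int}) (x : K) :
  lead_coef p \is a GRing.unit -> root (intp K p) x ->
  exists q : {poly int}, [/\ q \is monic, root (intp K q) x & size q = size p].
Proof.
move=> /orP[/eqP l1|/eqP l1] px.
  by exists p; split => //; apply/monicP.
exists (- p); split.
- by apply/monicP; rewrite lead_coefN l1 opprK.
- have -> : intp K (- p) = - intp K p by exact: (rmorphN (map_poly (intr : int -> K))).
  by rewrite rootN.
- by rewrite size_polyN.
Qed.

(** A monic integer polynomial of least degree vanishing at [x] is irreducible over the rationals:
    by Gauss's lemma a proper factor can be taken integral, both leading coefficients are then
    units, and one factor would be a smaller choice. *)
Lemma exists_min_poly (K : numFieldType) (F : {poly int}) (x : K) :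
  F \is monic -> root (intp K F) x ->
  exists p : {poly int}, [/\ p \is monic, irreducible_poly (intp rat p)
    & root (intp K p) x].
Proof.
have [m] := ubnP (size F); elim: m F => // m IH F; rewrite ltnS => sF mF Fx.
have [[G [mG Gx sG]]|noG] := pselect (exists G : {poly int},
    [/\ G \is monic, root (intp K G) x & (size G < size F)%N]).
  by apply: (IH G) => //; exact: leq_trans sG sF.
exists F; split => //; split.
  rewrite size_intp ltnNge; apply/negP => F1.
  have FE : F = 1.
    by move: mF; rewrite (size1_polyC F1) monicE lead_coefC => /eqP ->.
  by move: Fx; rewrite FE /root /intp map_polyC hornerC oner_eq0.
move=> q q1 qF.
have [p1 [a a0 Eq] [r EF]] := dvdpP_rat_int qF.
have lu : lead_coef p1 * lead_coef r = 1 by rewrite -lead_coefM -EF (monicP mF).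
have sp1 : size p1 != 1%N by move: q1; rewrite Eq size_scale // size_intp.
have p10 : p1 != 0 by apply: contra_eq_neq lu => ->; rewrite lead_coef0 mul0r eq_sym oner_eq0.
have r0 : r != 0 by apply: contra_eq_neq lu => ->; rewrite lead_coef0 mulr0 eq_sym oner_eq0.
have sF' : size F = (size p1 + size r).-1 by rewrite EF size_mul.
have sp1' : (1 < size p1)%N by move: sp1 p10; rewrite -size_poly_gt0; case: (size p1) => [|[]].
have sr' : (0 < size r)%N by rewrite size_poly_gt0.
have u1 : lead_coef p1 \is a GRing.unit by apply/unitrP; exists (lead_coef r); split; rewrite // mulrC.
have u2 : lead_coef r \is a GRing.unit by apply/unitrP; exists (lead_coef p1); split; rewrite // mulrC.
move: Fx; rewrite {1}EF intpM rootM => /orP[h|h].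
  have [g [mg gx sg]] := unit_lead_monic u1 h.
  rewrite Eq; apply: (eqp_trans (eqp_scale _ a0)); rewrite -dvdp_size_eqp.
    rewrite !size_intp eqn_leq; apply/andP; split.
      by rewrite sF' -(prednK sr') addnS /= leq_addr.
    by rewrite leqNgt; apply/negP => sl; apply: noG; exists g; rewrite sg.
  by rewrite EF intpM dvdp_mulr.
have [g [mg gx sg]] := unit_lead_monic u2 h.
case: noG; exists g; split => //; rewrite sg sF'.
by move: sp1' sr'; case: (size p1) => [|[|k]] //; case: (size r) => // l _ _; rewrite !addSn /= ltnS leq_addl.
Qed.

Lemma root_intp_real (R : rcfType) (q : {poly int}) (x : R) :
  root (intp R[i] q) (x%:C)%C = root (intp R q) x.
Proof.
rewrite -(fmorph_root (real_complex R)); congr (root _ _).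
by apply/polyP => i; rewrite !coef_map /= rmorph_int.
Qed.

(** An eigenvector of [M^2] is either killed by [M - w] or sent by it to an eigenvector of [M] for
    [- w]. *)
Lemma root_char_poly_sqr (K : numClosedFieldType) n (M : 'M[K]_n) (w : K) :
  root (char_poly (M *m M)) (w ^+ 2) ->
  root (char_poly M) w \/ root (char_poly M) (- w).
Proof.
rewrite -!eigenvalue_root_char => /eigenvalueP[v vM v0].
have [u0|u0] := eqVneq (v *m M - w *: v) 0.
  by left; apply/eigenvalueP; exists v => //; apply/eqP; rewrite -subr_eq0 u0.
right; apply/eigenvalueP; exists (v *m M - w *: v) => //.
rewrite mulmxBl -mulmxA vM -scalemxAl scaleNr scalerBr scalerA -expr2 opprB.
by [].
Qed.

(** No conjugate of [s] is 1, -1 or a root of [h], because [s] would share the vanishing; so at most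
    [s] and [- s] lie outside the open disc. In the case [b] the conjugates of [s ^+ 2] are found
    among the eigenvalues of the squared companion matrix, that is, the squares of conjugates of
    [s], so [- s] is harmless. *)
Lemma pisot_criterion (R : realType) (b : bool) (s : R) (F h : {poly int}) :
  1 < s -> F \is monic -> root (intp R F) s -> ~~ root (intp R h) s ->
  (forall z : R[i], root (intp R[i] F) z -> 1 <= `|z| ->
     [\/ z = (s%:C)%C, b /\ z = - (s%:C)%C, z = 1 \/ z = - 1
       | root (intp R[i] h) z]) ->
  pisot (if b then s ^+ 2 else s).
Proof.
move=> s1 mF Fs hs HF.
have [p [mp ip ps]] := exists_min_poly mF Fs.
have key (z : R[i]) : root (intp R[i] p) z -> 1 <= `|z| ->
    z = (s%:C)%C \/ (b /\ z = - (s%:C)%C).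
  move=> pz z1.
  have Fz := irreducible_common_root ip ps pz Fs.
  case: (HF z Fz z1) => [->|[hb ->]|pm1|hz]; [by left|by right| |].
    have [c [cz cs]] : exists c : {poly int}, root (intp R[i] c) z /\ ~~ root (intp R c) s.
      case: pm1 => ->.
        exists ('X - 1%:P); rewrite /intp !map_polyXsubC !root_XsubC; split=> //.
        by rewrite gt_eqF.
      exists ('X - (-1)%:P); rewrite /intp !map_polyXsubC !root_XsubC; split=> //; rewrite /= ?mulrN1z //.
      by rewrite gt_eqF // (lt_trans _ s1) // (lt_trans (ltrN10 _)) ?ltr01.
    by rewrite (irreducible_common_root ip pz ps cz) in cs.
  by rewrite (irreducible_common_root ip pz ps hz) in hs.
have Nge (z : R[i]) : ~~ (`|z| < 1) -> 1 <= `|z|.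
  by rewrite -real_leNgt ?normr_real ?real1.
case: b HF key => HF key.
  pose M : 'M[int]_((size p).-1) := companionmx p.
  pose M2 := M *m M.
  have pE (K : numFieldType) : intp K p = char_poly (map_mx intr M).
    by rewrite -intp_char_poly companionmxK.
  have qE (K : numFieldType) : intp K (char_poly M2) = char_poly (map_mx intr M *m map_mx intr M).
    by rewrite intp_char_poly map_mxM.
  have qs : root (intp R (char_poly M2)) (s ^+ 2).
    move: ps; rewrite pE qE -!eigenvalue_root_char => /eigenvalueP[v vM v0].
    by apply/eigenvalueP; exists v => //; rewrite mulmxA vM -scalemxAl vM scalerA.
  have [q [mq iq qqs]] := exists_min_poly (char_poly_monic M2) qs.
  split; first by rewrite expr_gt1 // ltW // (lt_trans ltr01).
  exists q; split; first by split.
  move=> z qz zs.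
  have := irreducible_common_root iq qqs qz qs.
  have zE : z = (sqrtC z) ^+ 2 by rewrite sqrtCK.
  rewrite qE zE => /root_char_poly_sqr hw.
  have [//|/Nge z1] := boolP (`|sqrtC z ^+ 2| < 1).
  have w1 : 1 <= `|sqrtC z|.
    by move: z1; rewrite normrX expr_ge1.
  have zs' : sqrtC z ^+ 2 = ((s ^+ 2)%:C)%C.
    rewrite rmorphXn /=.
    case: hw; rewrite -pE => /key.
      by case/(_ w1) => [->|[_ ->]]; rewrite ?sqrrN.
    rewrite normrN => /(_ w1) [/(canRL (@opprK _)) ->|[_ /oppr_inj ->]]; by rewrite ?sqrrN.
  by move: zs; rewrite {1}zE zs' eqxx.
split => //; exists p; split; first by split.
move=> z pz zs; have [//|/Nge z1] := boolP (`|z| < 1).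
by case: (key z pz z1) => [h0|[]//]; rewrite h0 eqxx in zs.
Qed.

(** * Spectral theory of real symmetric matrices *)

Section Spectral.
Variable R : rcfType.

Lemma Re_sum (I : Type) (r : seq I) (P : pred I) (F : I -> R[i]) :
  complex.Re (\sum_(i <- r | P i) F i) = \sum_(i <- r | P i) complex.Re (F i).
Proof. by apply: (big_morph (@complex.Re R)) => // -[a b] [c d]. Qed.

Lemma Im_sum (I : Type) (r : seq I) (P : pred I) (F : I -> R[i]) :
  complex.Im (\sum_(i <- r | P i) F i) = \sum_(i <- r | P i) complex.Im (F i).
Proof. by apply: (big_morph (@complex.Im R)) => // -[a b] [c d]. Qed.

Definition ReIm (b : bool) (z : R[i]) := if b then complex.Im z else complex.Re z.

Lemma ReIm_sum b (I : Type) (r : seq I) (P : pred I) (F : I -> R[i]) :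
  ReIm b (\sum_(i <- r | P i) F i) = \sum_(i <- r | P i) ReIm b (F i).
Proof. by case: b; rewrite /ReIm ?Re_sum ?Im_sum. Qed.

Lemma ReIm_mulr b (x : R) (z : R[i]) : ReIm b (x%:C%C * z) = x * ReIm b z.
Proof.
case: b; case: z => u v; rewrite /ReIm /=; by rewrite mul0r ?addr0 ?subr0.
Qed.

Lemma Re_conjM (z w : R[i]) :
  complex.Re (Num.conj z * w) = \sum_b ReIm b z * ReIm b w.
Proof.
by rewrite big_bool; case: z w => [a b] [c d] /=; rewrite mulNr opprK addrC.
Qed.

Variables (n : nat) (A : 'M[R]_n).
Hypothesis symA : A^T = A.

Let AC : 'M[R[i]]_n := map_mx (real_complex R) A.
Let U := spectralmx AC.
Let D := spectral_diag AC.

Lemma spectral_herm : AC \is hermsymmx.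
Proof.
apply: realsym_hermsym.
  apply/is_hermitianmxP; rewrite expr0 scale1r map_mx_id //.
  by apply/matrixP => i j; rewrite !mxE -{1}symA mxE.
by apply/mxOverP => i j; rewrite mxE complex_real.
Qed.

Let D_real i : D 0 i = (complex.Re (D 0 i))%:C%C.
Proof.
have /mxOverP/(_ 0 i) h := hermitian_spectral_diag_real spectral_herm.
by rewrite RRe_real.
Qed.

Let UA : U *m AC = diag_mx D *m U.
Proof.
have /hermitian_normalmx/orthomx_spectralP E := spectral_herm.
by rewrite {1}E !mulmxA mulmxV ?mul1mx // spectral_unit.
Qed.

Let UtU : (U ^t* *m U = 1%:M)%sesqui.
Proof.
have /unitarymxP h := spectral_unitarymx AC.
by rewrite -invmx_unitary ?spectral_unitarymx // mulVmx // spectral_unit.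
Qed.

(* The real and imaginary parts of a unitary eigenbasis form a Parseval frame of real eigenvectors. *)
Lemma spectral_frame : exists (d : 'I_n * bool -> R) (p : 'I_n * bool -> 'I_n -> R),
  (forall j u, \sum_v A u v * p j v = d j * p j u) /\
  (forall u v, \sum_j p j u * p j v = (u == v)%:R).
Proof.
exists (fun j => complex.Re (D 0 j.1)), (fun j u => ReIm j.2 (U j.1 u)); split.
  move=> [i b] u /=.
  rewrite -ReIm_mulr -D_real.
  have := congr1 (fun M : 'M_n => M i u) UA; rewrite mul_diag_mx mxE [in RHS]mxE => <-.
  rewrite ReIm_sum; apply: eq_bigr => v _.
  rewrite mxE mulrC [in RHS]mulrC ReIm_mulr mulrC.
  by rewrite -[in LHS]symA mxE.
move=> u v.
have := congr1 (fun M : 'M_n => complex.Re (M u v)) UtU; rewrite !mxE Re_sum.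
have -> : complex.Re ((u == v)%:R : R[i]) = (u == v)%:R by case: (u == v).
move=> <-.
rewrite -(pair_bigA _ (fun i b => ReIm b (U i u) * ReIm b (U i v))) /=.
by apply: eq_bigr => i _; rewrite !mxE Re_conjM.
Qed.

(** Multiplicity one means that [lam] occurs at most once on the diagonal of the unitary
    diagonalisation, so both vectors are supported there on one common coordinate. The 2 by 2 minors
    express proportionality and cover zero vectors too. *)
Lemma simple_eigenspace (lam : R) (q : {poly R}) (x y : 'I_n -> R) :
  char_poly A = q * ('X - lam%:P) -> ~~ root q lam ->
  (forall u, \sum_v A u v * x v = lam * x u) ->
  (forall u, \sum_v A u v * y v = lam * y u) ->
  forall u v, x u * y v = x v * y u.
Proof.
move=> pE qN xE yE.
have pC : char_poly AC = \prod_(i < n) ('X - (D 0 i)%:P).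
  transitivity (char_poly (diag_mx D)); last first.
    rewrite (char_poly_trig (diag_mx_is_trig D)).
    by apply: eq_bigr => i _; rewrite mxE eqxx mulr1n.
  rewrite /char_poly; apply/esym.
  have UE : U \in unitmx by exact: spectral_unit.
  have -> : char_poly_mx (diag_mx D) =
      map_mx polyC U *m char_poly_mx AC *m map_mx polyC (invmx U).
    rewrite /char_poly_mx mulmxBr mulmxBl -!map_mxM UA mulmxK //; congr (_ - _).
    by rewrite mul_mx_scalar -scalemxAl -map_mxM mulmxV // map_mx1 scalemx1.
  rewrite !det_mulmx mulrC mulrA -det_mulmx -map_mxM mulVmx // map_mx1 det1.
  by rewrite mul1r.
pose toP := map_poly (real_complex R).
pose lamC := (lam%:C)%C.
have uniqD i j : D 0 i = lamC -> D 0 j = lamC -> i = j.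
  move=> Di Dj; apply/eqP; apply: contraNT qN => ij.
  have : toP q * ('X - lamC%:P) = ('X - lamC%:P) * (('X - lamC%:P) *
      \prod_(k < n | (k != i) && (k != j)) ('X - (D 0 k)%:P)).
    have <- : toP (char_poly A) = toP q * ('X - lamC%:P).
      by rewrite pE /toP rmorphM /= map_polyXsubC.
    rewrite /toP map_char_poly -/AC pC (bigD1 i) //= (bigD1 j) /= ?Di ?Dj //.
    by rewrite eq_sym.
  have X0 : 'X - lamC%:P != 0 by rewrite polyXsubC_eq0.
  rewrite [LHS]mulrC => /(mulfI X0) qE.
  have : root (toP q) lamC by rewrite qE rootM root_XsubC eqxx.
  by rewrite fmorph_root.
pose xC : 'cV[R[i]]_n := \col_u (x u)%:C%C.
pose yC : 'cV[R[i]]_n := \col_u (y u)%:C%C.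
have eigC (z : 'I_n -> R) : (forall u, \sum_v A u v * z v = lam * z u) ->
    forall i, D 0 i * (U *m \col_u (z u)%:C%C) i 0 = lamC * (U *m \col_u (z u)%:C%C) i 0.
  move=> zE i.
  have -> : D 0 i * (U *m \col_u (z u)%:C%C) i 0 = (diag_mx D *m (U *m \col_u (z u)%:C%C)) i 0.
    by rewrite mul_diag_mx mxE.
  rewrite mulmxA -UA -mulmxA.
  have -> : AC *m \col_u (z u)%:C%C = lamC *: \col_u (z u)%:C%C.
    apply/matrixP => u k; rewrite !mxE -rmorphM /= -zE rmorph_sum.
    by apply: eq_bigr => v _; rewrite !mxE rmorphM.
  by rewrite -scalemxAr mxE.
have x1 := eigC _ xE; have y1 := eigC _ yE; rewrite -/xC -/yC in x1 y1.
have [lD|[i0 Di0]] : (forall i, D 0 i != lamC) \/ exists i, D 0 i = lamC.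
  have [/existsP[i /eqP]|] := boolP [exists i, D 0 i == lamC]; first by right; exists i.
  by rewrite negb_exists => /forallP; left.
  have x0 : U *m xC = 0.
    apply/matrixP => i k; rewrite ord1 [RHS]mxE; apply/eqP.
    move/eqP: (x1 i); rewrite -subr_eq0 -mulrBl mulf_eq0 subr_eq0.
    by rewrite (negbTE (lD i)).
  have xC0 : xC = 0 by rewrite -[xC](mulKmx (spectral_unit AC)) x0 mulmx0.
  have x00 u : x u = 0.
    by have := congr1 (fun M : 'cV_n => complex.Re (M u 0)) xC0; rewrite !mxE.
  by move=> u v; rewrite !x00 !mul0r.
have off (z : 'cV[R[i]]_n) i : (forall i, D 0 i * (U *m z) i 0 = lamC * (U *m z) i 0) ->
    i != i0 -> (U *m z) i 0 = 0.
  move=> z1 ii0; apply/eqP.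
  move/eqP: (z1 i); rewrite -subr_eq0 -mulrBl mulf_eq0 subr_eq0.
  case/orP => // /eqP Di; by rewrite (uniqD i i0) ?eqxx in ii0.
have xy : (U *m yC) i0 0 *: xC = (U *m xC) i0 0 *: yC.
  apply: (can_inj (mulKmx (spectral_unit AC))); rewrite -/U -!scalemxAr.
  apply/matrixP => i k; rewrite ord1.
  have [->|ii0] := eqVneq i i0; rewrite [LHS]mxE [RHS]mxE; first exact: mulrC.
  have hX : (U *m xC) i 0 = 0 := off xC i x1 ii0.
  have hY : (U *m yC) i 0 = 0 := off yC i y1 ii0.
  by transitivity (0 : R[i]); [apply: etrans (congr1 _ hX) _ | apply/esym; apply: etrans (congr1 _ hY) _]; rewrite mulr0.
have [c0|c0] := eqVneq ((U *m yC) i0 0) 0.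
  have y0 : U *m yC = 0.
    apply/matrixP => i k; rewrite ord1 [RHS]mxE.
      by have [->|ii0] := eqVneq i i0; [rewrite c0|rewrite (off yC)].
  have yC0 : yC = 0 by rewrite -[yC](mulKmx (spectral_unit AC)) y0 mulmx0.
  have y00 u : y u = 0.
    by have := congr1 (fun M : 'cV_n => complex.Re (M u 0)) yC0; rewrite !mxE.
  by move=> u v; rewrite !y00 !mulr0.
move=> u v.
have Ew w : (U *m yC) i0 0 * (x w)%:C%C = (U *m xC) i0 0 * (y w)%:C%C.
  by have := congr1 (fun M : 'cV_n => M w 0) xy; rewrite [LHS]mxE [RHS]mxE [xC w 0]mxE [yC w 0]mxE.
apply: (@complexI R); rewrite !rmorphM /=; apply: (mulfI c0).
by rewrite !mulrA !Ew -!mulrA; congr (_ * _); rewrite mulrC.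
Qed.
End Spectral.

Lemma sum_delta (K : pzRingType) n (f : 'I_n -> K) u : \sum_w f w * (w == u)%:R = f u.
Proof.
rewrite (bigD1 u) //= eqxx mulr1 [X in _ + X]big1 ?addr0 // => w wu.
by rewrite (negbTE wu) mulr0.
Qed.

(** * Spectral measures and variational estimates *)

Section Measure.
Variable R : rcfType.

Definition eigenfun n (A : 'M[R]_n) (x : R) (y : 'I_n -> R) : Prop :=
  (exists u, y u != 0) /\ forall u, \sum_v A u v * y v = x * y u.

Lemma eigenfun_root n (A : 'M[R]_n) (x : R) :
  A^T = A -> root (char_poly A) x <-> exists y, eigenfun A x y.
Proof.
move=> sA; have sA' u v : A u v = A v u by rewrite -{1}sA mxE.
rewrite -eigenvalue_root_char; split.
  move=> /eigenvalueP[v vA v0]; exists (v 0); split; first exact/rV0Pn.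
  move=> u; have /rowP/(_ u) := vA; rewrite !mxE => <-.
  by apply: eq_bigr => w _; rewrite mulrC sA'.
move=> [y [[u yu] yE]]; apply/eigenvalueP; exists (\row_u y u).
  apply/rowP => w; rewrite !mxE -yE; apply: eq_bigr => k _.
  by rewrite mxE mulrC sA'.
by apply: contraNneq yu => /rowP/(_ u); rewrite !mxE => ->.
Qed.

(** The weights [c j ^+ 2] at the points [d j] form the spectral measure of [w]; mass and first two
    moments are all that the estimates below need. The last clause lets orthogonality to an
    eigenspace exclude its eigenvalue from the support. *)
Lemma spectral_measure n (A : 'M[R]_n) (w : 'I_n -> R) : A^T = A ->
  exists (J : finType) (d c : J -> R),
  [/\ \sum_j c j ^+ 2 = \sum_u w u ^+ 2,
      \sum_j d j * c j ^+ 2 = \sum_u w u * \sum_v A u v * w v,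
      \sum_j d j ^+ 2 * c j ^+ 2 = \sum_u (\sum_v A u v * w v) ^+ 2 &
      forall j, c j != 0 ->
        exists2 y, eigenfun A (d j) y & \sum_u y u * w u != 0].
Proof.
move=> sA; have sA' u v : A u v = A v u by rewrite -{1}sA mxE.
have [d [p [pE pP]]] := spectral_frame sA.
have parseval (w1 w2 : 'I_n -> R) :
    \sum_j (\sum_u p j u * w1 u) * (\sum_u p j u * w2 u) = \sum_u w1 u * w2 u.
  under eq_bigr do rewrite mulr_suml.
  rewrite exchange_big; apply: eq_bigr => u _ /=.
  under eq_bigr do rewrite mulr_sumr.
  rewrite exchange_big /= (bigD1 u) //= [X in _ + X]big1 => [|v vu].
    rewrite addr0; under eq_bigr do rewrite mulrACA.
    by rewrite -mulr_suml pP eqxx mul1r.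
  under eq_bigr do rewrite mulrACA.
  by rewrite -mulr_suml pP eq_sym (negbTE vu) mul0r.
have adj j : \sum_u p j u * (\sum_v A u v * w v) = d j * \sum_u p j u * w u.
  under eq_bigr do rewrite mulr_sumr.
  rewrite exchange_big mulr_sumr; apply: eq_bigr => v _ /=.
  rewrite mulrA -pE mulr_suml; apply: eq_bigr => u _.
  by rewrite sA' mulrA [p j u * _]mulrC.
exists _, d, (fun j => \sum_u p j u * w u); split.
- by rewrite (eq_bigr (fun u => w u * w u)) // -parseval.
- by rewrite -parseval; apply: eq_bigr => j _; rewrite adj expr2; ring.
- rewrite [RHS](eq_bigr (fun u => (\sum_v A u v * w v) * (\sum_v A u v * w v))) //.
  by rewrite -parseval; apply: eq_bigr => j _; rewrite adj !expr2; ring.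
move=> j cj; exists (p j) => //; split => //.
have [/existsP //|] := boolP [exists u, p j u != 0].
rewrite negb_exists => /forallP h; case/eqP: cj; rewrite big1 // => u _.
by have /negPn/eqP -> := h u; rewrite mul0r.
Qed.

Lemma eigenvalue_gt n (A : 'M[R]_n) (w : 'I_n -> R) (x : R) : A^T = A ->
  \sum_u w u * (x * w u - \sum_v A u v * w v) < 0 ->
  exists x' y, x < x' /\ eigenfun A x' y.
Proof.
move=> sA; have [J [d [c [c1 c2 _ cE]]]] := spectral_measure w sA.
have -> : \sum_u w u * (x * w u - \sum_v A u v * w v) = \sum_j (x - d j) * c j ^+ 2.
  transitivity (x * (\sum_j c j ^+ 2) - \sum_j d j * c j ^+ 2).
    rewrite c1 c2 mulr_sumr -sumrB; apply: eq_bigr => u _; ring.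
  by rewrite mulr_sumr -sumrB; apply: eq_bigr => j _; ring.
move=> neg.
have [/existsP[j /andP[dj cj]]|] := boolP [exists j, (x < d j) && (c j != 0)].
  by have [y yE _] := cE j cj; exists (d j), y.
rewrite negb_exists => /forallP h; move: neg; rewrite ltNge sumr_ge0 // => j _.
have [->|cj] := eqVneq (c j) 0; first by rewrite expr0n mulr0.
by rewrite mulr_ge0 ?sqr_ge0 // subr_ge0 leNgt; have := h j; rewrite cj andbT.
Qed.

Lemma eigenvalue_near n (A : 'M[R]_n) (w : 'I_n -> R) (x eps : R) : A^T = A ->
  (exists u, w u != 0) ->
  \sum_u (\sum_v A u v * w v - x * w u) ^+ 2 <= eps * \sum_u w u ^+ 2 ->
  exists x' y, (x' - x) ^+ 2 <= eps /\ eigenfun A x' y.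
Proof.
move=> sA [u0 wu0]; have [J [d [c [c1 c2 c3 cE]]]] := spectral_measure w sA.
have -> : \sum_u (\sum_v A u v * w v - x * w u) ^+ 2 = \sum_j (d j - x) ^+ 2 * c j ^+ 2.
  transitivity (\sum_j d j ^+ 2 * c j ^+ 2 - 2 * x * (\sum_j d j * c j ^+ 2) + x ^+ 2 * (\sum_j c j ^+ 2)).
    rewrite c1 c2 c3 !mulr_sumr -sumrB -big_split; apply: eq_bigr => u _ /=; ring.
  by rewrite !mulr_sumr -sumrB -big_split; apply: eq_bigr => j _ /=; ring.
rewrite -c1 mulr_sumr -subr_le0 -sumrB => le0.
have [/existsP[j /andP[dj cj]]|] := boolP [exists j, ((d j - x) ^+ 2 <= eps) && (c j != 0)].
  by have [y yE _] := cE j cj; exists (d j), y.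
rewrite negb_exists => /forallP h.
have pos j : 0 <= (d j - x) ^+ 2 * c j ^+ 2 - eps * c j ^+ 2.
  have [->|cj] := eqVneq (c j) 0; first by rewrite expr0n !mulr0 subr0.
  rewrite -mulrBl mulr_ge0 ?sqr_ge0 // subr_ge0.
  by have := h j; rewrite cj andbT -ltNge => /ltW.
have c0 j : c j = 0.
  have : \sum_j ((d j - x) ^+ 2 * c j ^+ 2 - eps * c j ^+ 2) == 0.
    by rewrite eq_le le0 sumr_ge0.
  rewrite psumr_eq0 // => /allP/(_ j (mem_index_enum j)) /=.
  rewrite -mulrBl mulf_eq0 => /orP[|]; last by rewrite expf_eq0 => /eqP.
  rewrite subr_eq0 => /eqP e; apply/eqP; have := h j.
  by rewrite e lexx /= negbK.
have : \sum_u w u ^+ 2 == 0 by rewrite -c1 big1 // => j _; rewrite c0 expr0n.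
rewrite psumr_eq0 => [|u _]; last by rewrite sqr_ge0.
by move=> /allP/(_ u0 (mem_index_enum u0)); rewrite /= expf_eq0 /= (negbTE wu0).
Qed.

Lemma norm_le_eigenvalue n (A : 'M[R]_n) (w : 'I_n -> R) (B : R) : A^T = A ->
  (forall x y, eigenfun A x y -> x ^+ 2 <= B) ->
  \sum_u (\sum_v A u v * w v) ^+ 2 <= B * \sum_u w u ^+ 2.
Proof.
move=> sA bd; have [J [d [c [c1 c2 c3 cE]]]] := spectral_measure w sA.
rewrite -c1 -c3 mulr_sumr ler_sum // => j _.
have [->|cj] := eqVneq (c j) 0; first by rewrite expr0n !mulr0.
by rewrite ler_wpM2r ?sqr_ge0 //; have [y yE _] := cE j cj; exact: bd yE.
Qed.

Lemma form_le_orthogonal n (A : 'M[R]_n) (xi w : 'I_n -> R) (lam x : R) : A^T = A ->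
  (forall z y, eigenfun A z y -> x < z -> z = lam) ->
  (forall y, eigenfun A lam y -> exists k, forall u, y u = k * xi u) ->
  \sum_u xi u * w u = 0 ->
  \sum_u w u * (\sum_v A u v * w v) <= x * \sum_u w u ^+ 2.
Proof.
move=> sA top simp orth; have [J [d [c [c1 c2 c3 cE]]]] := spectral_measure w sA.
rewrite -c1 -c2 mulr_sumr ler_sum // => j _.
have [->|cj] := eqVneq (c j) 0; first by rewrite expr0n !mulr0.
rewrite ler_wpM2r ?sqr_ge0 // leNgt; apply/negP => xd.
have [y yE yw] := cE j cj; have dl := top _ _ yE xd.
rewrite dl in yE; have [k kE] := simp _ yE.
case/eqP: yw; rewrite (eq_bigr (fun u => k * (xi u * w u))).
  by rewrite -mulr_sumr orth mulr0.
by move=> u _; rewrite kE mulrA.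
Qed.
End Measure.

(** * Salem graphs *)

Section Graph.
Variable R : realType.

Lemma adjacency_sum n (e : rel 'I_n) (y : 'I_n -> R) u :
  \sum_v adjacency R e u v * y v = \sum_(v | e u v) y v.
Proof.
rewrite [RHS]big_mkcond; apply: eq_bigr => v _; rewrite mxE.
by case: (e u v); rewrite ?mul1r ?mul0r.
Qed.

Lemma adjacency_sym n (e : rel 'I_n) : symmetric e -> (adjacency R e)^T = adjacency R e.
Proof. by move=> sym_e; apply/matrixP => u v; rewrite !mxE sym_e. Qed.

Definition graph_eigen n (e : rel 'I_n) (x : R) (y : 'I_n -> R) : Prop :=
  (exists u, y u != 0) /\ forall u, \sum_(v | e u v) y v = x * y u.

Lemma graph_eigenE n (e : rel 'I_n) x y :
  eigenfun (adjacency R e) x y <-> graph_eigen e x y.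
Proof. by split=> -[y0 yE]; split=> // u; rewrite -?yE adjacency_sum // -?yE. Qed.

(* [b] tells whether [-lam] is also allowed as an eigenvalue, i.e. the bipartite case. *)
Definition salem_spectrum n (e : rel 'I_n) (b : bool) (lam : R) : Prop :=
  [/\ symmetric e, 2 < lam, exists y, graph_eigen e lam y
    & forall x y, graph_eigen e x y -> 2 < `|x| -> x = lam \/ (b /\ x = - lam)].

Definition simple_eigen n (e : rel 'I_n) (lam : R) : Prop :=
  forall x y, graph_eigen e lam x -> graph_eigen e lam y ->
  exists k, forall u, y u = k * x u.

Lemma salem_graph_spectrum n (e : rel 'I_n) (lam : R) (b : bool) :
  simple_graph e -> salem_graph e lam -> (bipartite e <-> b) ->
  salem_spectrum e b lam /\ simple_eigen e lam.
Proof.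
move=> [sym_e _] [[lam2 rlam] mup1 top nonbip bip] bE.
have sA := adjacency_sym sym_e.
have rootE x : root (charpoly_graph R e) x <-> exists y, graph_eigen e x y.
  split; first by move=> /(eigenfun_root _ sA)[y /graph_eigenE]; exists y.
  by move=> [y /graph_eigenE yE]; apply/(eigenfun_root _ sA); exists y.
split.
  split => //; first exact/rootE.
  move=> x y yE; rewrite lter_normr => /orP[x2|x2].
    by left; apply: top => //; apply/rootE; exists y.
  have xneg : x < -2 by rewrite ltrNr.
  have rx : root (charpoly_graph R e) x by apply/rootE; exists y.
  case: b bE => bE.
    have /bip[_ h] : bipartite e by apply/bE.
    by right; split=> //; apply: h.
  have /nonbip/(_ x xneg) : ~ bipartite e by move/bE.
  by rewrite rx.
have cp0 : charpoly_graph R e != 0 by rewrite monic_neq0 // char_poly_monic.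
have /factor_theorem[q qE] := rlam.
have q0 : q != 0 by apply: contraNneq cp0 => q0; rewrite qE q0 mul0r.
have qN : ~~ root q lam.
  rewrite -dvdp_XsubCl XsubC_dvd // -leqNgt leqn0.
  have m1 : mup lam ('X - lam%:P) = 1%N by rewrite -[_ - _]expr1 mup_XsubCX eqxx.
  have := mup1; rewrite /= qE mupM ?polyXsubC_eq0 // m1 addn1 => -[->].
  by [].
move=> x y xE yE.
have /graph_eigenE[[u0 xu0] xE'] := xE; have /graph_eigenE[_ yE'] := yE.
exists (y u0 / x u0) => u.
have h := simple_eigenspace sA qE qN xE' yE' u u0.
by apply: (mulIf xu0); rewrite mulrAC divfK // mulrC -h mulrC.
Qed.

Definition component n (e : rel 'I_n) (w : 'I_n) : rel 'I_n :=
  fun u v => [&& e u v, connect e w u & connect e w v].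

(** The component kept is that of a vertex where the eigenvector of [lam] does not vanish. The other
    vertices become isolated and add only the eigenvalue 0, so eigenvectors for nonzero eigenvalues
    vanish there and remain eigenvectors of [e]. *)
Lemma salem_spectrum_component n (e : rel 'I_n) (b : bool) (lam : R) :
  salem_spectrum e b lam -> simple_eigen e lam ->
  exists e' : rel 'I_n, [/\ salem_spectrum e' b lam, simple_eigen e' lam,
    connected_graph e' & subrel e' e].
Proof.
move=> [sym_e lam2 [xi [[w xiw] xiE]] spec] simp.
pose e' := component e w; exists e'.
have Vadj u v : e u v -> connect e w u = connect e w v.
  move=> uv; apply/idP/idP => h; apply: (connect_trans h); apply: connect1 => //.
  by rewrite sym_e.
have e'V u v : connect e w u -> e' u v = e u v.
  move=> Vu; rewrite /e' /component Vu andTb; case: (boolP (e u v)) => //= uv.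
  by rewrite -(Vadj _ _ uv).
have e'N u v : ~~ connect e w u -> e' u v = false.
  by move=> Vu; rewrite /e' /component (negbTE Vu) andbF.
have sym_e' : symmetric e'.
  by move=> u v; rewrite /e' /component sym_e; congr (_ && _); rewrite andbC.
have lift x y : x != 0 -> graph_eigen e' x y -> graph_eigen e x y.
  move=> x0 [y0 yE]; split=> // u.
  have yN v : ~~ connect e w v -> y v = 0.
    move=> Vv; apply/eqP; have /eqP := yE v; rewrite big1 => [|k].
      by rewrite eq_sym mulf_eq0 (negbTE x0).
    by rewrite e'N.
  have [Vu|Vu] := boolP (connect e w u).
    by rewrite -yE; apply: eq_bigl => v; rewrite e'V.
  by rewrite yN // mulr0 big1 // => v uv; rewrite yN // -(Vadj _ _ uv).
have lam0 : lam != 0 by rewrite gt_eqF // (lt_trans _ lam2).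
split.
- split=> //.
    exists (fun u => if connect e w u then xi u else 0); split.
      by exists w; rewrite connect0.
    move=> u; have [Vu|Vu] := boolP (connect e w u).
      rewrite -xiE; apply: eq_big => v; first by rewrite e'V.
      by rewrite e'V // => /Vadj; rewrite Vu => <-.
    by rewrite mulr0 big1 // => v; rewrite e'N.
  move=> x y yE x2; apply: (spec _ _ _ x2); apply: lift yE.
  by apply: contraTneq x2 => ->; rewrite normr0 -leNgt.
- by move=> x y xE yE; apply: simp; exact: lift.
- move=> X clX u v uX du dv.
  have Vpos k : (0 < deg e' k)%N -> connect e w k.
    move=> h; apply: contraLR h => Vk; rewrite -leqNgt leqn0 cards_eq0; apply/eqP/setP => j.
    by rewrite !inE e'N.
  have Vu := Vpos _ du; have Vv := Vpos _ dv.
  pose a := [pred k | connect e w k && (k \in X)].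
  have cla : fingraph.closed e a.
    move=> i j ij; rewrite /a !inE -(Vadj _ _ ij); case: (boolP (connect e w i)) => //= Vi.
    apply/idP/idP => h; apply: clX h _; rewrite ?e'V -?(Vadj _ _ ij) //.
    by rewrite sym_e.
  have uv : connect e u v.
    by apply: connect_trans Vv; rewrite (sym_connect_sym sym_e).
  by have := closed_connect cla uv; rewrite /a !inE Vu uX Vv => /esym.
by move=> u v /and3P[].
Qed.

Definition gform n (e : rel 'I_n) (y : 'I_n -> R) : R :=
  \sum_u y u * (2 * y u - \sum_(v | e u v) y v).

(** Some nonzero combination of [y] and [z] is orthogonal to the eigenvector of [lam], where the
    form of [2 - A] is nonnegative; separated supports kill the cross terms, so the form would be
    negative on it. *)
Lemma salem_no_two_negative n (e : rel 'I_n) b lam (y z : 'I_n -> R) :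
  salem_spectrum e b lam -> simple_eigen e lam ->
  gform e y < 0 -> gform e z < 0 ->
  (forall u v, y u != 0 -> z v != 0 -> u != v /\ ~~ e u v) -> False.
Proof.
move=> [sym_e lam2 [xi xiE] spec] simp y_neg z_neg sep.
have nonpos w : \sum_u xi u * w u = 0 -> 0 <= gform e w.
  move=> orth.
  have sA := adjacency_sym sym_e.
  have := @form_le_orthogonal R n (adjacency R e) xi w lam 2 sA.
  have -> : gform e w = 2 * (\sum_u w u ^+ 2) - \sum_u w u * \sum_v adjacency R e u v * w v.
    rewrite mulr_sumr -sumrB; apply: eq_bigr => u _.
    by rewrite adjacency_sum; ring.
  rewrite subr_ge0; apply=> //.
    move=> x k /graph_eigenE kE x2.
      have x2' : 2 < `|x| by rewrite (lt_le_trans x2) // ler_norm.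
      case: (spec _ _ kE x2') => [//|[_ xE]].
    by move: x2 lam2; rewrite xE; lra.
  by move=> k /graph_eigenE kE; apply: simp.
have gformC (s t : R) : gform e (fun u => s * y u + t * z u) = s ^+ 2 * gform e y + t ^+ 2 * gform e z.
  rewrite /gform !mulr_sumr -big_split; apply: eq_bigr => u _ /=.
  rewrite big_split /= -!mulr_sumr.
  have [yu|yu] := eqVneq (y u) 0.
    have [->|zu] := eqVneq (z u) 0; first by rewrite yu; ring.
    rewrite yu [\sum_(v | e u v) y v]big1; first by ring.
    move=> v uv; apply/eqP/negPn/negP => yv.
    by have [_ /negP[]] := sep _ _ yv zu; rewrite sym_e.
  have -> : z u = 0.
    by apply/eqP/negPn/negP => zu; have [] := sep _ _ yu zu; rewrite eqxx.
  rewrite [\sum_(v | e u v) z v]big1; first by ring.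
  by move=> v uv; apply/eqP/negPn/negP => zv; have [_ /negP[]] := sep _ _ yu zv.
pose s := \sum_u xi u * z u; pose t := - \sum_u xi u * y u.
have [s0|s0] := eqVneq s 0.
  by have := nonpos z s0; rewrite leNgt z_neg.
have : 0 <= gform e (fun u => s * y u + t * z u).
  apply: nonpos; rewrite (eq_bigr (fun u => s * (xi u * y u) + t * (xi u * z u))).
    by rewrite big_split /= -!mulr_sumr -/s /t; ring.
  by move=> u _; ring.
rewrite gformC leNgt => /negP[].
have s2 : 0 < s ^+ 2 by rewrite exprn_even_gt0.
by rewrite ltr_wnDr ?nmulr_llt0 // mulr_ge0_le0 ?sqr_ge0 // ltW.
Qed.

Definition test_vector n (e : rel 'I_n) (S : {set 'I_n}) (u : 'I_n) : R :=
  2 * (u \in S)%:R + (u \in outer e S)%:R.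

(** A vertex of [S] contributes [8 - 4 deg] plus 2 for each boundary neighbour; a boundary vertex
    contributes at most 2 minus 2 for each neighbour in [S]. In the sum the edges between the two
    sets cancel. *)
Lemma gform_test_vector n (e : rel 'I_n) (S : {set 'I_n}) :
  symmetric e -> S \subset deg2 e ->
  gform e (test_vector e S) <= 2 * #|outer e S|%:R - 4 * (excess e S)%:R.
Proof.
move=> sym_e S2.
pose s u : R := (u \in S)%:R; pose t u : R := (u \in outer e S)%:R.
have st u : s u * t u = 0.
  rewrite /s /t; case: (boolP (u \in S)) => uS; last by rewrite mul0r.
  by rewrite inE uS mulr0.
have s2 u : s u * s u = s u by rewrite /s; case: (u \in S); rewrite ?mul1r ?mul0r.
have t2 u : t u * t u = t u by rewrite /t; case: (u \in _); rewrite ?mul1r ?mul0r.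
have degS u : u \in S -> \sum_(v | e u v) (s v + t v) = (deg e u)%:R.
  move=> uS; rewrite /deg -sum1_card natr_sum.
  apply: eq_big => [v|v uv]; first by rewrite inE.
  have : v \in cl e S by apply: cl_adj uv.
  rewrite /s /t; case: (boolP (v \in S)) => vS vcl.
    by rewrite inE vS addr0.
  by rewrite inE vS vcl add0r.
have step u : test_vector e S u * (2 * test_vector e S u - \sum_(v | e u v) test_vector e S v)
  <= s u * (8 - 4 * (deg e u)%:R) + 2 * t u + (2 * \sum_(v | e u v) s u * t v - 2 * \sum_(v | e u v) t u * s v).
  rewrite /test_vector -/(s u) -/(t u) (eq_bigr (fun v => 2 * s v + t v)) //.
  rewrite big_split /= -!mulr_sumr.
  have st' : 0 <= \sum_(v | e u v) t v by apply: sumr_ge0 => v _; rewrite ler0n.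
  have sdeg : s u * (\sum_(v | e u v) s v + \sum_(v | e u v) t v) = s u * (deg e u)%:R.
    rewrite -big_split /= /s; case: (boolP (u \in S)) => uS; last by rewrite !mul0r.
    by rewrite degS.
  have h1 := st u; have h2 := s2 u; have h3 := t2 u.
  have tu : 0 <= t u by rewrite ler0n.
  move: st' sdeg; set a := \sum_(v | e u v) s v; set c := \sum_(v | e u v) t v => c0 sdeg.
  have tc : 0 <= t u * c by rewrite mulr_ge0.
  have -> : (2 * s u + t u) * (2 * (2 * s u + t u) - (2 * a + c)) =
    8 * (s u * s u) + 8 * (s u * t u) + 2 * (t u * t u) - 4 * (s u * (a + c)) + 2 * (s u * c)
     - 2 * (t u * a) - t u * c by ring.
  rewrite h1 h2 h3 sdeg; lra.
rewrite /gform; apply: le_trans (ler_sum _ (fun u _ => step u)) _.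
rewrite !big_split /= -mulr_sumr sumrN -!mulr_sumr.
have -> : \sum_u \sum_(v | e u v) s u * t v = \sum_u \sum_(v | e u v) t u * s v.
  rewrite (exchange_big_dep xpredT) //=; apply: eq_bigr => u _.
  apply: eq_big => [v|v _]; first by rewrite /= sym_e.
  exact: mulrC.
rewrite subrr addr0.
have -> : \sum_u t u = #|outer e S|%:R.
  by rewrite -sum1_card natr_sum [RHS]big_mkcond; apply: eq_bigr => u _; rewrite /t; case: (u \in _).
have -> : \sum_u s u * (8 - 4 * (deg e u)%:R) = - 4 * (excess e S)%:R.
  rewrite /excess natr_sum [in RHS]big_mkcond mulr_sumr; apply: eq_bigr => u _.
  rewrite /s; case: (boolP (u \in S)) => uS; last by rewrite mul0r mulr0.
  have : (1 < deg e u)%N by have := fintype.subsetP S2 u uS; rewrite inE.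
  by move=> h; rewrite natrB //= mul1r; ring.
lra.
Qed.

(** The adjacency matrix maps the indicator of [u] to that of its neighbourhood, of squared norm
    [deg e u], and its squared operator norm is at most [d]; eigenvalues in [[-2, 2]] are covered
    because [lam > 2]. *)
Lemma salem_deg_le n (e : rel 'I_n) b (lam : R) (d : nat) :
  salem_spectrum e b lam -> lam ^+ 2 <= d%:R -> forall u, (deg e u <= d)%N.
Proof.
move=> [sym_e lam2 _ spec] ld u.
have sA := adjacency_sym sym_e.
have bd x y : eigenfun (adjacency R e) x y -> x ^+ 2 <= d%:R.
  move=> /graph_eigenE yE; apply: le_trans ld.
  have [x2|x2] := ltP 2 `|x|.
    by have [->|[_ ->]] := spec _ _ yE x2; rewrite ?sqrrN.
  by rewrite -[x ^+ 2]real_normK ?num_real // lerXn2r ?nnegrE //; lra.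
have := norm_le_eigenvalue (fun v => (v == u)%:R) sA bd.
have -> : \sum_w (w == u)%:R ^+ 2 = 1 :> R.
  transitivity (\sum_w 1 * (w == u)%:R : R); last exact: (sum_delta (fun=> 1)).
  by apply: eq_bigr => w _; rewrite mul1r; case: (w == u); rewrite /= ?expr1n ?expr0n.
rewrite mulr1.
have -> : \sum_v (\sum_w adjacency R e v w * (w == u)%:R) ^+ 2 = (deg e u)%:R.
  rewrite /deg -sum1_card natr_sum [RHS]big_mkcond; apply: eq_bigr => v _.
  by rewrite sum_delta mxE inE sym_e; case: (e u v); rewrite /= ?expr1n ?expr0n.
by rewrite ler_nat.
Qed.

Lemma salem_core_exists (d : nat) : exists K : nat,
  forall n (e : rel 'I_n) b (lam : R),
    salem_spectrum e b lam -> simple_eigen e lam -> connected_graph e ->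
    lam ^+ 2 <= d%:R ->
    exists C : {set 'I_n}, (#|C| <= K)%N /\ forall u, u \notin C -> (deg e u <= 2)%N.
Proof.
eexists=> n e b lam spec simp conn ld; exists (branch e); split; last first.
  by move=> u; rewrite inE -leqNgt.
have dle := salem_deg_le spec ld; have [sym_e _ _ _] := spec.
apply: (card_branch_bounded sym_e dle conn) => S1 S2 S12 S22 neg1 neg2 sep.
have negative (S : {set 'I_n}) : S \subset deg2 e -> (#|outer e S| < 2 * excess e S)%N ->
    gform e (test_vector e S) < 0.
  move=> SS; rewrite -(ltr_nat R) natrM => h.
  apply: le_lt_trans (gform_test_vector sym_e SS) _; lra.
apply: (salem_no_two_negative spec simp (negative _ S12 neg1) (negative _ S22 neg2)).
have supp (S : {set 'I_n}) u : test_vector e S u != 0 -> u \in cl e S.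
  apply: contraNT => ucl; rewrite /test_vector.
  have uS : u \notin S by apply: contra ucl => uS; exact: (fintype.subsetP (sub_cl _ _)).
  by rewrite inE uS (negbTE ucl) (negbTE uS) mulr0 addr0.
by move=> u v /supp hu /supp hv; apply: sep.
Qed.
End Graph.

(** * Paths leaving the core *)

Section Walk.
Variables (n : nat) (e : rel 'I_n).
Implicit Types C : {set 'I_n}.

(** The index counts vertices: [p] and the next [K - 1] of them are outside [C] with exactly two
    neighbours, and nothing is asked of the one after. *)
Fixpoint walk C (K : nat) (u p : 'I_n) : Prop :=
  if K is K'.+1 then
    p \notin C /\ exists q, [/\ q != u, (forall v, e p v = (v == u) || (v == q)) & walk C K' p q]
  else True.

Definition boundary C := [set uv : 'I_n * 'I_n | [&& uv.1 \in C, uv.2 \notin C & e uv.1 uv.2]].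

Lemma walk_leq C K K' u p : (K' <= K)%N -> walk C K u p -> walk C K' u p.
Proof.
elim: K' K u p => [|K' IH] [|K] u p //= KK [pC [q [qu pE w]]].
by split=> //; exists q; split=> //; apply: IH w.
Qed.

Lemma walk_sub C C' K u p : C \subset C' -> walk C' K u p -> walk C K u p.
Proof.
move=> /fintype.subsetP CC; elim: K u p => [|K IH] u p //= [pC [q [qu pE w]]].
by split; [apply: contra pC; exact: CC|exists q; split=> //; exact: IH].
Qed.

Hypotheses (sym_e : symmetric e) (irr_e : irreflexive e).

(** Following the path enlarges [C] one vertex at a time, trading the boundary edge [(u, p)] for
    [(p, q)]. If within [K] steps the path ends or returns to [C], the last edge is traded for
    nothing and the boundary strictly shrinks. *)
Lemma absorb_walk C K u p : (forall v, v \notin C -> (deg e v <= 2)%N) ->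
  u \in C -> p \notin C -> e u p ->
  walk C K u p \/ exists C', [/\ C \subset C', (#|C'| <= #|C| + K)%N
    & (#|boundary C'| < #|boundary C|)%N].
Proof.
elim: K C u p => [|K IH] C u p deg_le uC pC up; first by left.
have up_b : (u, p) \in boundary C by rewrite inE /= uC pC.
have [[q [qu pq qC]]|noq] := pselect (exists q, [/\ q != u, e p q & q \notin C]); last first.
  right; exists (p |: C); split. exact: subsetUr.
    by rewrite cardsU1 pC /= add1n addnS ltnS leq_addr.
  rewrite (cardsD1 (u, p) (boundary C)) up_b add1n ltnS.
  apply: subset_leq_card; apply/fintype.subsetP => -[a c].
  rewrite !inE /= negb_or => /and3P[/orP[/eqP ->|aC] /andP[cp cC] ac].
    case: noq; exists c; split=> //; apply: contraNneq cC => ->; exact: uC.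
  by rewrite aC cC ac !andbT; apply: contraNneq cp => -[_ ->].
have pE v : e p v = (v == u) || (v == q).
  apply/idP/orP => [pv|[/eqP ->|/eqP -> //]]; last by rewrite sym_e.
  have := deg_le p pC; rewrite /deg (cardsD1 u) inE sym_e up (cardsD1 q) !inE qu pq /= !add1n !ltnS.
  rewrite leqn0 cards_eq0 => /eqP/setP/(_ v); rewrite !inE pv andbT.
  by case: (v == q); case: (v == u); rewrite /=; [right|right|left|].
have qC1 : q \notin p |: C.
  by rewrite !inE negb_or qC andbT; apply: contraTneq pq => ->; rewrite irr_e.
have deg1 v : v \notin p |: C -> (deg e v <= 2)%N.
  by rewrite !inE negb_or => /andP[_]; exact: deg_le.
have bd : (#|boundary (p |: C)| <= #|boundary C|)%N.
  rewrite (cardsD1 (u, p) (boundary C)) up_b addnC addn1.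
  rewrite -[_.+1]addn1 -(cards1 (p, q)).
  apply: leq_trans (leq_card_setU _ _).1.
  apply: subset_leq_card; apply/fintype.subsetP => -[a c].
  rewrite !inE /= negb_or => /and3P[/orP[/eqP ->|aC] /andP[cp cC] ac].
    apply/orP; right; apply/eqP; congr (_, _); apply/eqP.
    move: ac; rewrite pE => /orP[/eqP cu|//]; by rewrite cu uC in cC.
  by rewrite aC cC ac !andbT; apply/orP; left; apply: contraNneq cp => -[_ ->].
have [w|[C' [C1 C2 C3]]] := IH (p |: C) p q deg1 (setU11 _ _) qC1 pq.
  left; split=> //; exists q; split=> //.
  by apply: walk_sub w; exact: subsetUr.
right; exists C'; split.
- by apply: subset_trans C1; exact: subsetUr.
- by apply: leq_trans C2 _; rewrite cardsU1 pC /= addnS add1n addSn.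
- exact: leq_trans C3 bd.
Qed.

Lemma card_boundary_le C d : (forall v, (deg e v <= d)%N) -> (#|boundary C| <= #|C| * d)%N.
Proof.
move=> dle; have sub : boundary C \subset \bigcup_(u in C) [set (u, v) | v in [set v | e u v]].
  apply/fintype.subsetP => -[u v]; rewrite inE /= => /and3P[uC _ uv].
  by apply/bigcupP; exists u => //; apply/imsetP; exists v; rewrite ?inE.
apply: leq_trans (subset_leq_card sub) _; rewrite -sum_nat_const.
elim/big_ind2: _ => [|A a B b ha hb|v _]; first by rewrite cards0.
  exact: leq_trans (leq_card_setU _ _) (leq_add ha hb).
by rewrite card_imset ?dle // => x y [].
Qed.
End Walk.

(** * Extraction of a family with one fixed core *)

Section Family.
Variable R : realType.

Definition sample (b : bool) (s : R) (d : nat) (eps sg : R) n (e : rel 'I_n) (C : {set 'I_n}) : Prop :=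
  [/\ salem_spectrum e b (sg + sg^-1), 1 < sg, 0 < `|sg - s| < eps, irreflexive e &
      (forall u, (deg e u <= d)%N) /\ forall u, u \notin C -> (deg e u <= 2)%N].

Definition all_walks n (e : rel 'I_n) (C : {set 'I_n}) (K : nat) : Prop :=
  forall u p, u \in C -> p \notin C -> e u p -> walk e C K u p.

(** Induction on the bound [k] for the boundary edges. If cores of size [N] do not serve all [eps]
    and [K], some pair [eps0], [K0] fails; then every sample closer than [eps0] has a path shorter
    than [K0], and absorbing it costs at most [K0] vertices and lowers [k]. *)
Lemma long_walks b s d N k :
  (forall eps, 0 < eps -> exists sg n (e : rel 'I_n) C,
     [/\ sample b s d eps sg e C, (#|C| <= N)%N & (#|boundary e C| <= k)%N]) ->
  exists N', forall eps K, 0 < eps -> exists sg n (e : rel 'I_n) C,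
     [/\ sample b s d eps sg e C, (#|C| <= N')%N & all_walks e C K].
Proof.
elim: k N => [|k IH] N H.
  exists N => eps K eps0; have [sg [n [e [C [sC NC]]]]] := H eps eps0.
  rewrite leqn0 cards_eq0 => /eqP bd; exists sg, n, e, C; split=> // u p uC pC up.
  by move/setP/(_ (u, p)): bd; rewrite !inE /= uC pC up.
have [good|bad] := pselect (forall eps K, 0 < eps -> exists sg n (e : rel 'I_n) C,
     [/\ sample b s d eps sg e C, (#|C| <= N)%N & all_walks e C K]); first by exists N.
have [eps0 [K0 [eps00 no]]] : exists eps0 K0, 0 < eps0 /\ ~ exists sg n (e : rel 'I_n) C,
     [/\ sample b s d eps0 sg e C, (#|C| <= N)%N & all_walks e C K0].
  apply: contrapT => h; apply: bad => eps K eps_pos; apply: contrapT => h'.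
  by apply: h; exists eps, K.
apply: (IH (N + K0)%N) => eps eps_pos.
have m0 : 0 < Num.min eps eps0 by rewrite lt_min eps_pos.
have [sg [n [e [C [[sp sg1 /andP[ne cl] irr [dle d2]] NC bd]]]]] := H _ m0.
move: cl; rewrite lt_min => /andP[cl1 cl2].
have sC : sample b s d eps0 sg e C by split; rewrite ?ne.
have [[u [p [uC pC up nw]]]|all] := pselect (exists u p, [/\ u \in C, p \notin C, e u p & ~ walk e C K0 u p]); last first.
  case: no; exists sg, n, e, C; split=> // u p uC pC up; apply: contrapT => nw.
  by apply: all; exists u, p.
have [sym_e _ _ _] := sp.
have [//|[C' [CC C'N bd']]] := absorb_walk sym_e irr K0 d2 uC pC up.
exists sg, n, e, C'; split.
- split=> //; first by rewrite ne.
  split=> // v vC; apply: d2; apply: contra vC; exact: (fintype.subsetP CC).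
- by apply: leq_trans C'N _; rewrite leq_add2r.
- by rewrite -ltnS; apply: leq_trans bd' bd.
Qed.

Lemma pigeonhole (T : finType) (P : T -> nat -> Prop) :
  (forall t m m', (m' <= m)%N -> P t m -> P t m') ->
  (forall m, exists t, P t m) -> exists t, forall m, P t m.
Proof.
move=> mono ex; apply: contrapT => no.
have /boolp.choice[f fP] : forall t, exists m, ~ P t m.
  move=> t; apply: contrapT => h; apply: no; exists t => m; apply: contrapT => h'.
  by apply: h; exists m.
have [t tP] := ex (\max_t f t)%N.
by apply: (fP t); apply: mono tP; exact: leq_bigmax.
Qed.

(* All members share the adjacency [a] of the core and the numbers [D] of edges leaving it; their parameters [sg] tend to [s] without reaching it. *)
Definition core_family (b : bool) (s : R) c (a : rel 'I_c) (D : 'I_c -> nat) : Prop :=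
  forall eps K, 0 < eps -> exists sg n (e : rel 'I_n) (i : 'I_c -> 'I_n),
    [/\ [/\ salem_spectrum e b (sg + sg^-1), 1 < sg & 0 < `|sg - s| < eps],
        injective i, (forall x y, e (i x) (i y) = a x y),
        (forall x, #|[set v | e (i x) v & v \notin codom i]| = D x) &
        (forall u, u \notin codom i -> (deg e u <= 2)%N) /\ all_walks e [set i x | x : 'I_c] K].

(** Core size, core adjacency and outgoing degrees range over a finite type, so one value occurs for
    every [m] with precision [1 / (m + 1)] and paths of length [m]. *)
Lemma exists_core_family b s d N :
  (forall eps K, 0 < eps -> exists sg n (e : rel 'I_n) C,
     [/\ sample b s d eps sg e C, (#|C| <= N)%N & all_walks e C K]) ->
  exists c (a : rel 'I_c) (D : 'I_c -> nat), core_family b s a D.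
Proof.
move=> H.
pose T : finType := {c : 'I_N.+1 & ({ffun 'I_c * 'I_c -> bool} * {ffun 'I_c -> 'I_d.+1})%type}.
pose P (t : T) (m : nat) := exists sg n (e : rel 'I_n) (i : 'I_(tag t) -> 'I_n),
    [/\ [/\ salem_spectrum e b (sg + sg^-1), 1 < sg & 0 < `|sg - s| < m.+1%:R^-1],
        injective i, (forall x y, e (i x) (i y) = (tagged t).1 (x, y)),
        (forall x, #|[set v | e (i x) v & v \notin codom i]| = (tagged t).2 x) &
        (forall u, u \notin codom i -> (deg e u <= 2)%N) /\ all_walks e [set i x | x : 'I_(tag t)] m].
have [|m|t tP] := @pigeonhole T P.
- move=> t m m' mm [sg [n [e [i [[sp sg1 /andP[ne cl]] inj aE DE [d2 w]]]]]].
  exists sg, n, e, i; split=> //.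
    split=> //; rewrite ne (lt_le_trans cl) // lef_pV2 ?posrE ?ltr0n // ler_nat //.
  by split=> // u p uC pC up; apply: walk_leq mm _; apply: w.
- have m0 : 0 < m.+1%:R^-1 :> R by rewrite invr_gt0 ltr0n.
  have [sg [n [e [C [[sp sg1 cl irr [dle d2]] NC w]]]]] := H _ m m0.
  have NC' : (#|C| < N.+1)%N by [].
  pose i : 'I_(Ordinal NC') -> 'I_n := fun x => enum_val (A := mem C) x.
  have inj : injective i by apply: enum_val_inj.
  have codE v : (v \in codom i) = (v \in C).
    apply/codomP/idP => [[x ->]|vC]; first exact: enum_valP.
    by exists (enum_rank_in vC v); rewrite /i enum_rankK_in.
  have Dlt x : (#|[set v | e (i x) v & v \notin codom i]| < d.+1)%N.
    rewrite ltnS; apply: leq_trans (dle (i x)); apply: subset_leq_card.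
    by apply/fintype.subsetP => v; rewrite !inE => /andP[].
  exists (Tagged (fun c : 'I_N.+1 => ({ffun 'I_c * 'I_c -> bool} * {ffun 'I_c -> 'I_d.+1})%type)
    ([ffun xy => e (i xy.1) (i xy.2)], [ffun x => Ordinal (Dlt x)])).
  exists sg, n, e, i; split=> //=.
  + by move=> x y; rewrite ffunE.
  + by move=> x; rewrite ffunE.
  + split=> [u|]; first by rewrite codE; exact: d2.
    have -> : [set i x | x : 'I_(Ordinal NC')] = C; last exact: w.
    apply/setP => v; rewrite -codE; apply/imsetP/codomP => [[x _ ->]|[x ->]]; first by exists x.
    by exists x.
case: t tP => c [a D] tP; exists c, (fun x y => a (x, y)), (fun x => nat_of_ord (D x)) => eps K eps0.
pose m := maxn K (Num.trunc eps^-1).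
have meps : m.+1%:R^-1 <= eps.
  rewrite -[leRHS]invrK lef_pV2 ?posrE ?invr_gt0 ?ltr0n //.
  apply: le_trans (ltW (truncnS_gt _)) _.
  by rewrite ler_nat ltnS leq_maxr.
have [sg [n [e [i [[sp sg1 /andP[ne cl]] inj aE DE [d2 w]]]]]] := tP m.
exists sg, n, e, i; split=> //.
  by split=> //; rewrite ne (lt_le_trans cl).
split=> // u p uC pC up; apply: (@walk_leq _ _ _ m); first exact: leq_maxl.
exact: w.
Qed.
End Family.

(** * Harmonic functions and their decay along paths *)

Section Decay.
Variable R : realType.

Lemma exp_small (r eps : R) : 1 < r -> 0 < eps -> exists K, forall z, r <= z -> z ^- K < eps.
Proof.
move=> r1 eps0.
have bern K : 1 + K%:R * (r - 1) <= r ^+ K.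
  elim: K => [|K IH]; first by rewrite mul0r addr0 expr0.
  rewrite exprS -natr1.
  have h : r * (1 + K%:R * (r - 1)) <= r * r ^+ K by rewrite ler_wpM2l // ltW // (lt_trans ltr01).
  apply: le_trans h; have k0 : 0 <= K%:R :> R by rewrite ler0n.
  have : 0 <= K%:R * (r - 1) * (r - 1) by rewrite -mulrA mulr_ge0 // -expr2 sqr_ge0.
  by lra.
pose K := (Num.trunc (eps^-1 / (r - 1))).+1.
exists K => z rz; have r0 : 0 < r by rewrite (lt_trans ltr01).
have rK : eps^-1 < r ^+ K.
  apply: lt_le_trans (bern K); apply: (@lt_trans _ _ (K%:R * (r - 1))); last by rewrite ltrDr.
  by rewrite -ltr_pdivrMr ?subr_gt0 // truncnS_gt.
have zK : eps^-1 < z ^+ K.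
  by apply: lt_le_trans rK _; rewrite lerXn2r // nnegrE ltW // (lt_le_trans r0).
have z0 : 0 < z ^+ K by apply: lt_trans zK; rewrite invr_gt0.
by rewrite -[ltRHS]invrK ltf_pV2 ?posrE ?invr_gt0.
Qed.

Lemma norm_add_inv_gt2 (z : R) : 1 < `|z| -> 2 < `|z + z^-1|.
Proof.
move=> z1; have z0 : z != 0 by rewrite -normr_gt0 (lt_trans _ z1).
have pos (t : R) : 1 < t -> 2 < t + t^-1.
  move=> t1; have t0 : 0 < t by rewrite (lt_trans _ t1).
  have : 0 < (t - 1) ^+ 2 / t by rewrite divr_gt0 // exprn_gt0 // subr_gt0.
  have -> : (t - 1) ^+ 2 / t = t + t^-1 - 2 by field; rewrite gt_eqF.
  by rewrite subr_gt0.
have [zp|zn] := leP 0 z.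
  by rewrite (ger0_norm zp) in z1; rewrite (lt_le_trans (pos _ z1)) // ler_norm.
rewrite (ltr0_norm zn) in z1; rewrite (lt_le_trans (pos _ z1)) // -normrN opprD -invrN.
exact: ler_norm.
Qed.

Lemma add_inv_inj (z s : R) : 1 < `|z| -> 1 < `|s| -> z + z^-1 = s + s^-1 -> z = s.
Proof.
move=> z1 s1 E.
have z0 : z != 0 by rewrite -normr_gt0 (lt_trans _ z1).
have s0 : s != 0 by rewrite -normr_gt0 (lt_trans _ s1).
have zs : z * s != 1.
  apply: contraTneq z1 => h; rewrite -leNgt.
  have : `|z| * `|s| = 1 by rewrite -normrM h normr1.
  by move: (normr_ge0 z) s1; nra.
have : (z - s) * (z * s - 1) = (z * s) * ((z + z^-1) - (s + s^-1)) by field; rewrite z0 s0.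
rewrite E subrr mulr0 => /eqP; rewrite mulf_eq0 !subr_eq0 (negbTE zs) orbF.
by move=> /eqP.
Qed.

Lemma add_inv_ltW (z s : R) : 1 < z -> 1 < s -> z + z^-1 < s + s^-1 -> z < s.
Proof.
move=> z1 s1; apply: contraTT; rewrite -!leNgt => sz.
have z0 : 0 < z by rewrite (lt_trans _ z1). have s0 : 0 < s by rewrite (lt_trans _ s1).
have : 0 <= (z - s) * (z * s - 1) / (z * s).
  rewrite divr_ge0 ?mulr_ge0 ?subr_ge0 ?(ltW z0) ?(ltW s0) //.
  by move: z1 s1; nra.
have -> : (z - s) * (z * s - 1) / (z * s) = (z + z^-1) - (s + s^-1).
  by field; rewrite !gt_eqF.
by rewrite subr_ge0.
Qed.

Lemma add_inv_lipschitz (z s : R) : 1 <= z -> 1 <= s -> `|(z + z^-1) - (s + s^-1)| <= `|z - s|.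
Proof.
move=> z1 s1.
have z0 : 0 < z by rewrite (lt_le_trans _ z1). have s0 : 0 < s by rewrite (lt_le_trans _ s1).
have -> : (z + z^-1) - (s + s^-1) = (z - s) * (1 - (z * s)^-1).
  by field; rewrite !gt_eqF.
rewrite normrM -[leRHS]mulr1 ler_wpM2l //.
have zs : 1 <= z * s by rewrite -[1]mulr1 ler_pM.
have h1 : (z * s)^-1 <= 1 by rewrite invf_le1 // mulr_gt0.
have h2 : 0 < (z * s)^-1 by rewrite invr_gt0 mulr_gt0.
by rewrite ler_norml; apply/andP; split; lra.
Qed.

Section Harmonic.
Variables (n : nat) (e : rel 'I_n) (C : {set 'I_n}) (z : R).
Hypothesis deg_le : forall u, u \notin C -> (deg e u <= 2)%N.
Hypothesis z1 : 1 < `|z|.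

Definition harmonic (y : 'I_n -> R) :=
  forall p, p \notin C -> \sum_(v | e p v) y v = (z + z^-1) * y p.

(** Maximum principle: where [y] has maximal modulus outside [C], at most two neighbours bound the
    modulus of [(z + z^-1) * y q] by twice that of [y q], which forces [y q = 0]. *)
Lemma harmonic_max y m : 0 <= m -> harmonic y -> (forall u, u \in C -> `|y u| <= m) ->
  forall p, `|y p| <= m.
Proof.
move=> m0 hy yC p.
case: (@Order.TotalTheory.arg_maxP _ _ _ p xpredT (fun q => `|y q|) isT) => q _ qmax.
apply: le_trans (qmax p isT) _.
have [|qC] := boolP (q \in C); first exact: yC.
suff -> : `|y q| = 0 by [].
have le2 : `|(z + z^-1) * y q| <= 2 * `|y q|.
  rewrite -hy //; apply: le_trans (ler_norm_sum _ _ _) _.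
  apply: (@le_trans _ _ (\sum_(v | e q v) `|y q|)).
    by apply: ler_sum => v _; exact: qmax.
  rewrite sumr_const -[leLHS]mulr_natl ler_wpM2r // ler_nat.
  apply: leq_trans (deg_le qC); rewrite /deg; apply: eq_leq; apply: eq_card => v.
  by rewrite !inE.
have x2 := norm_add_inv_gt2 z1.
move: le2; rewrite normrM => le2; have q0 := normr_ge0 (y q).
by apply/eqP; rewrite eq_le q0 andbT leNgt; apply/negP => qp; nra.
Qed.

(** The deviation [y p - z^-1 * y u] from pure decay is multiplied by [z] at each step of the path,
    yet never exceeds [2 * m] in modulus; so it starts out exponentially small in [K]. *)
Lemma harmonic_decay y m K u p : harmonic y -> (forall v, `|y v| <= m) ->
  walk e C K u p -> `|y p - z^-1 * y u| <= 2 * m * `|z| ^- K.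
Proof.
have z0 : z != 0 by rewrite -normr_gt0 (lt_trans _ z1).
move=> hy ym; elim: K u p => [|K IH] u p.
  move=> _; rewrite expr0 invr1 mulr1.
  apply: le_trans (ler_normB _ _) _; rewrite normrM normfV.
  have h1 : `|z|^-1 <= 1 by rewrite invf_le1 ?(ltW z1) // (lt_trans ltr01).
  have h2 : `|z|^-1 * `|y u| <= 1 * m by rewrite ler_pM // invr_ge0.
  by have := ym p; lra.
move=> /= [pC [q [qu pE w]]].
have qE : y q = (z + z^-1) * y p - y u.
  rewrite -(hy p pC) (eq_bigl (fun v => (v == u) || (v == q))) //.
  rewrite (bigD1 u) ?eqxx //= (bigD1 q) /=; last by rewrite eqxx orbT.
  rewrite big1 ?addr0; first by ring.
  by move=> v /andP[/andP[/orP[/eqP ->|/eqP ->]]]; rewrite eqxx.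
have := IH _ _ w; rewrite qE.
have -> : (z + z^-1) * y p - y u - z^-1 * y p = z * (y p - z^-1 * y u) by field.
rewrite normrM exprS invfM mulrCA => h.
by rewrite -ler_pdivlMl ?normr_gt0 // in h.
Qed.

(** A Dirichlet problem: a square linear system, with uniqueness given by the maximum principle,
    hence solvable. *)
Lemma harmonic_extension (v : 'I_n -> R) :
  exists y, (forall u, u \in C -> y u = v u) /\ harmonic y.
Proof.
pose B : 'M[R]_n := \matrix_(w, u)
  (if u \in C then (w == u)%:R else (z + z^-1) * (w == u)%:R - (e u w)%:R).
have BE (r : 'rV_n) u : (r *m B) 0 u =
    if u \in C then r 0 u else (z + z^-1) * r 0 u - \sum_(w | e u w) r 0 w.
  rewrite mxE; case: (boolP (u \in C)) => uC.
    rewrite -[RHS](sum_delta (r 0)); apply: eq_bigr => w _; by rewrite mxE uC.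
  rewrite [X in _ - X]big_mkcond /= -[X in _ * X](sum_delta (r 0)) mulr_sumr -sumrB.
  apply: eq_bigr => w _; rewrite mxE (negbTE uC).
  by case: (e u w); rewrite /=; ring.
have Bu : B \in unitmx.
  rewrite -row_free_unit; apply: inj_row_free => r rB.
  have rE u : (if u \in C then r 0 u else (z + z^-1) * r 0 u - \sum_(w | e u w) r 0 w) = 0.
    by rewrite -BE rB mxE.
  have hr : harmonic (r 0).
    by move=> p pC; have := rE p; rewrite (negbTE pC) => /eqP; rewrite subr_eq0 eq_sym => /eqP.
  have r0 u : u \in C -> `|r 0 u| <= 0 by move=> uC; have := rE u; rewrite uC => ->; rewrite normr0.
  apply/rowP => u; rewrite mxE; apply/eqP; rewrite -normr_le0.
  exact: harmonic_max r0 u.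
pose r := (\row_u (if u \in C then v u else 0)) *m invmx B.
have rB u : (r *m B) 0 u = if u \in C then v u else 0 by rewrite mulmxKV // mxE.
exists (r 0); split=> [u uC|p pC].
  by have := rB u; rewrite BE uC.
have := rB p; rewrite BE (negbTE pC) => /eqP; rewrite subr_eq0 eq_sym.
by move=> /eqP.
Qed.
End Harmonic.

Lemma mem_imset_codom c n (i : 'I_c -> 'I_n) u : (u \in [set i x | x : 'I_c]) = (u \in codom i).
Proof. by apply/imsetP/codomP => [[x _ ->]|[x ->]]; exists x. Qed.

Section Core.
Variables (c : nat) (a : rel 'I_c) (D : 'I_c -> nat).

(* The limit, as the walks leaving the core become infinite, of the Schur complement on the core of [(z + z^-1) - adjacency]: an infinite path has Green function [z^-1]. *)
Definition core_op (z : R) (v : 'I_c -> R) (x : 'I_c) : R :=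
  (z + z^-1) * v x - \sum_(y | a x y) v y - z^-1 * (D x)%:R * v x.

Variables (n : nat) (e : rel 'I_n) (i : 'I_c -> 'I_n).
Hypotheses (inj_i : injective i) (aE : forall x y, e (i x) (i y) = a x y).
Hypothesis DE : forall x, #|[set v | e (i x) v & v \notin codom i]| = D x.

Lemma sum_split_core (y : 'I_n -> R) x :
  \sum_(w | e (i x) w) y w = \sum_(x' | a x x') y (i x') +
    \sum_(w | e (i x) w && (w \notin codom i)) y w.
Proof.
rewrite (bigID (mem (codom i))) /=; congr (_ + _).
rewrite (reindex_onto i (fun w => if w \in codom i is true then odflt x [pick x' | i x' == w] else x)) /=; last first.
  by move=> w /andP[_ wi]; rewrite wi; case: pickP => [x' /eqP //|/(_ _)]; case/codomP: wi => x' -> /(_ x'); rewrite eqxx.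
apply: eq_bigl => x'; rewrite aE codom_f andbT.
case: pickP => [x'' /eqP/inj_i ->|/(_ x')]; first by rewrite eqxx andbT.
by rewrite eqxx.
Qed.

Lemma big_core (f : 'I_n -> R) : \sum_(w in codom i) f w = \sum_x f (i x).
Proof.
rewrite (eq_bigl (fun w => w \in [set i x | x : 'I_c])) => [|w].
  by rewrite big_imset => [|x x' _ _ /inj_i //]; apply: eq_bigl => x; rewrite inE.
by rewrite mem_imset_codom.
Qed.

Lemma core_residual z K y m x :
  (forall u, u \notin codom i -> (deg e u <= 2)%N) ->
  all_walks e [set i x | x : 'I_c] K ->
  1 < `|z| -> 0 <= m -> harmonic e [set i x | x : 'I_c] z y -> (forall x, `|y (i x)| <= m) ->
  `|(z + z^-1) * y (i x) - \sum_(w | e (i x) w) y w - core_op z (y \o i) x|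
    <= (D x)%:R * (2 * m * `|z| ^- K).
Proof.
move=> d2 w z1 m0 hy ym.
have CE := mem_imset_codom i.
have d2' u : u \notin [set i x | x : 'I_c] -> (deg e u <= 2)%N by rewrite CE; exact: d2.
have ym' u : `|y u| <= m.
  apply: (harmonic_max d2' z1 m0 hy) => v; rewrite CE => /codomP[x' ->]; exact: ym.
rewrite sum_split_core /core_op /=.
set S1 := \sum_(x' | a x x') y (i x').
have -> : (z + z^-1) * y (i x) - (S1 + \sum_(w0 | e (i x) w0 && (w0 \notin codom i)) y w0)
   - ((z + z^-1) * y (i x) - S1 - z^-1 * (D x)%:R * y (i x)) =
   - \sum_(w0 | e (i x) w0 && (w0 \notin codom i)) (y w0 - z^-1 * y (i x)).
  rewrite big_split /= sumr_const.
  have -> : #|[pred w0 | e (i x) w0 & w0 \notin codom i]| = D x.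
    by rewrite -DE; apply: eq_card => v; rewrite !inE.
  by rewrite mulNrn -mulr_natl; ring.
rewrite normrN; apply: le_trans (ler_norm_sum _ _ _) _.
apply: (@le_trans _ _ (\sum_(w0 | e (i x) w0 && (w0 \notin codom i)) (2 * m * `|z| ^- K))).
  apply: ler_sum => p /andP[xp pi].
  apply: (harmonic_decay z1 hy ym'); apply: w => //; first by rewrite CE codom_f.
  by rewrite CE.
rewrite sumr_const.
have -> : #|[pred w0 | e (i x) w0 & w0 \notin codom i]| = D x.
  by rewrite -DE; apply: eq_card => v; rewrite !inE.
by rewrite -[leLHS]mulr_natl.
Qed.
End Core.
End Decay.

(** * The limit of a family with a fixed core *)

Section Limit.
Variable R : realType.

(** At [z = 1] the core operator is [2 - A - D]. The full form has in addition half the sum of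
    [(y u - y v) ^+ 2] over ordered adjacent pairs not both in the core, and
    [(2 - deg e u) * y u ^+ 2] for each [u] outside it. *)
Lemma gform_ge_core c (a : rel 'I_c) (D : 'I_c -> nat) n (e : rel 'I_n) (i : 'I_c -> 'I_n) (y : 'I_n -> R) :
  symmetric e -> injective i -> (forall x y, e (i x) (i y) = a x y) ->
  (forall x, #|[set v | e (i x) v & v \notin codom i]| = D x) ->
  (forall u, u \notin codom i -> (deg e u <= 2)%N) ->
  \sum_x y (i x) * core_op a D 1 (y \o i) x <= gform e y.
Proof.
move=> sym_e inj aE DE d2.
pose g u v := e u v && ~~ ((u \in codom i) && (v \in codom i)).
have sym_g u v : g u v = g v u by rewrite /g sym_e andbC [in RHS]andbC [in X in ~~ X]andbC.
pose S := \sum_u \sum_(v | g u v) y u * (y u - y v).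
have S0 : 0 <= S.
  have S2 : S = \sum_u \sum_(v | g u v) y v * (y v - y u).
    rewrite /S (exchange_big_dep xpredT) //=; apply: eq_bigr => u _.
    by apply: eq_bigl => v; rewrite sym_g.
  have : 0 <= S + S.
    rewrite {1}S2 -big_split sumr_ge0 //= => u _; rewrite -big_split sumr_ge0 //= => v _.
    have -> : y v * (y v - y u) + y u * (y u - y v) = (y u - y v) ^+ 2 by ring.
    exact: sqr_ge0.
  by lra.
have main : \sum_x y (i x) * core_op a D 1 (y \o i) x + S <= gform e y.
  rewrite /S /gform (bigID (mem (codom i))) [leRHS](bigID (mem (codom i))) /= !(big_core inj) addrA.
  apply: lerD.
    rewrite -big_split; apply: ler_sum => x _ /=.
    have -> : \sum_(v | g (i x) v) y (i x) * (y (i x) - y v) =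
        y (i x) * ((D x)%:R * y (i x) - \sum_(w | e (i x) w && (w \notin codom i)) y w).
      rewrite (eq_bigl (fun w => e (i x) w && (w \notin codom i))) => [|w]; last by rewrite /g codom_f.
      rewrite -mulr_sumr sumrB sumr_const; congr (_ * (_ - _)).
      rewrite -[LHS]mulr_natl -DE; congr (_ * _); congr (_%:R).
      by apply: eq_card => v; rewrite !inE.
    rewrite (sum_split_core inj aE) /core_op /= invr1.
    rewrite le_eqVlt; apply/orP; left; apply/eqP; ring.
  apply: ler_sum => u uC.
  rewrite (eq_bigl (fun w => e u w)) => [|w]; last by rewrite /g (negbTE uC) andbT.
  rewrite -mulr_sumr sumrB sumr_const.
  have -> : #|[pred w | e u w]| = deg e u by apply: eq_card => v; rewrite !inE.
  rewrite !mulrBr lerD2r.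
  rewrite -[X in y u * X <= _]mulr_natl !(mulrCA (y u)) -expr2.
  by rewrite ler_wpM2r ?sqr_ge0 // ler_nat; exact: d2.
by apply: le_trans main; rewrite lerDl.
Qed.

Section WithFamily.
Variables (b : bool) (s : R) (c : nat) (a : rel 'I_c) (D : 'I_c -> nat).
Hypothesis fam : core_family b s a D.

Lemma core_family_symmetric : symmetric a.
Proof.
have [sg [n [e [i [[[sym_e _ _ _] _ _] _ aE _ _]]]]] := fam 0 ltr01.
by move=> x y; rewrite -!aE sym_e.
Qed.

Lemma core_not_psd : exists v : 'I_c -> R, \sum_x v x * core_op a D 1 v x < 0.
Proof.
have [sg [n [e [i [[[sym_e lam2 [y [[u0 yu0] yE]] _] _ _] inj aE DE [d2 _]]]]]] := fam 0 ltr01.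
exists (y \o i); apply: le_lt_trans (gform_ge_core y sym_e inj aE DE d2) _.
rewrite /gform (eq_bigr (fun u => (2 - (sg + sg^-1)) * y u ^+ 2)) => [|u _]; last by rewrite yE; ring.
rewrite -mulr_sumr nmulr_rlt0 ?subr_lt0 // lt0r sumr_ge0 => [|u _]; last exact: sqr_ge0.
rewrite andbT psumr_eq0 => [|u _]; last exact: sqr_ge0.
by apply/negP => /allP/(_ u0 (mem_index_enum _)); rewrite /= sqrf_eq0 (negbTE yu0).
Qed.

(** Continuity at [z = 1], made explicit: [z] times the form is a quadratic polynomial in [z]. *)
Lemma core_negative_gt1 : exists z (v : 'I_c -> R), 1 < z /\ \sum_x v x * core_op a D z v x < 0.
Proof.
have [v v_neg] := core_not_psd.
pose nu := \sum_x v x ^+ 2; pose al := \sum_x v x * \sum_(y | a x y) v y.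
pose de := \sum_x (D x)%:R * v x ^+ 2.
have E z : z != 0 -> z * (\sum_x v x * core_op a D z v x) = (z ^+ 2 + 1) * nu - z * al - de.
  move=> z0; rewrite /nu /al /de !mulr_sumr -!sumrB; apply: eq_bigr => x _.
  by rewrite /core_op; field.
have nu0 : 0 <= nu by apply: sumr_ge0 => x _; exact: sqr_ge0.
have := E 1 (oner_neq0 _); rewrite mul1r => E1.
pose q := - (\sum_x v x * core_op a D 1 v x).
have q0 : 0 < q by rewrite oppr_gt0.
have Eq : 2 * nu - al - de = - q by rewrite /q E1 opprK; ring.
(* As [t < 1], the polynomial grows by at most [t * X] from 1 to [1 + t]; the choice of [t] keeps
   this below [q]. *)
pose X := `|2 * nu - al| + nu.
have X0 : 0 <= X by rewrite addr_ge0.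
pose t := q / (q + X + 1).
have den : 0 < q + X + 1 by lra.
have t0 : 0 < t by rewrite divr_gt0.
have t1 : t < 1 by rewrite ltr_pdivrMr // mul1r; lra.
have tX : t * X < q.
  by rewrite /t mulrAC ltr_pdivrMr // ltr_pM2l //; lra.
exists (1 + t), v; split; first by lra.
have z0 : 0 < 1 + t by lra.
rewrite -(pmulr_rlt0 _ z0) E ?gt_eqF //.
have -> : ((1 + t) ^+ 2 + 1) * nu - (1 + t) * al - de =
  (2 * nu - al - de) + t * (2 * nu - al) + t ^+ 2 * nu by ring.
rewrite Eq; have h1 : t * (2 * nu - al) <= t * `|2 * nu - al| by rewrite ler_wpM2l ?ler_norm // ltW.
have h2 : t ^+ 2 * nu <= t * nu by rewrite ler_wpM2r // expr2 ger_pMl // ltW.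
by move: tX; rewrite /X mulrDr; lra.
Qed.

Lemma ler_sum_norm (v : 'I_c -> R) x : `|v x| <= \sum_x `|v x|.
Proof. by rewrite (bigD1 x) //= lerDl sumr_ge0. Qed.

Let Dsum : R := \sum_x (D x)%:R.
Let Dsum0 : 0 <= Dsum. Proof. by apply: sumr_ge0 => x _; rewrite ler0n. Qed.

Lemma D_le_sum x : (D x)%:R <= Dsum.
Proof. by rewrite /Dsum (bigD1 x) //= lerDl sumr_ge0 // => y _; rewrite ler0n. Qed.

(** To the harmonic extension of [v], long paths look infinite, so on the core the finite graph acts
    within [delta] of its limit. *)
Lemma approx_extension (z : R) (v : 'I_c -> R) (eps delta : R) :
  1 < `|z| -> 0 < eps -> 0 < delta ->
  exists sg n (e : rel 'I_n) (i : 'I_c -> 'I_n) (y : 'I_n -> R),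
    [/\ [/\ salem_spectrum e b (sg + sg^-1), 1 < sg & `|sg - s| < eps],
      injective i, (forall x, y (i x) = v x),
      (forall u, u \notin codom i -> \sum_(w | e u w) y w = (z + z^-1) * y u) &
      forall x, `|(z + z^-1) * v x - \sum_(w | e (i x) w) y w - core_op a D z v x| <= delta].
Proof.
move=> z1 eps0 delta0.
pose m := \sum_x `|v x|.
have m0 : 0 <= m by apply: sumr_ge0.
pose B := 2 * m * Dsum + 1.
have B0 : 0 < B by rewrite ltr_wpDl // !mulr_ge0.
have [K KP] := exp_small z1 (divr_gt0 delta0 B0).
have [sg [n [e [i [[sp sg1 /andP[_ cl]] inj aE DE [d2 w]]]]]] := fam K eps0.
pose C := [set i x | x : 'I_c].
have CE u : (u \in C) = (u \in codom i) by exact: mem_imset_codom.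
have d2' u : u \notin C -> (deg e u <= 2)%N by rewrite CE; exact: d2.
pose v' u := if u \in codom i is true then odflt 0 (omap v [pick x | i x == u]) else 0.
have v'E x : v' (i x) = v x.
  rewrite /v' codom_f; case: pickP => [x' /eqP/inj ->//|/(_ x)]; by rewrite eqxx.
have [y [yC hy]] := harmonic_extension d2' z1 v'.
have yE x : y (i x) = v x by rewrite yC ?v'E // CE codom_f.
exists sg, n, e, i, y; split=> //.
  by move=> u uC; apply: hy; rewrite CE.
move=> x.
have ym x' : `|y (i x')| <= m by rewrite yE ler_sum_norm.
have := core_residual inj aE DE x d2 w z1 m0 hy ym.
rewrite yE.
have -> : core_op a D z (y \o i) x = core_op a D z v x.
  by rewrite /core_op /= yE; congr (_ - _ - _); apply: eq_bigr => x' _; rewrite yE.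
move=> h; apply: le_trans h _.
have zK := KP _ (lexx _).
have zK0 : 0 <= `|z| ^- K by rewrite invr_ge0 exprn_ge0.
apply: (@le_trans _ _ (B * `|z| ^- K)).
  rewrite mulrA ler_wpM2r // /B; have := D_le_sum x.
  have : 0 <= (D x)%:R :> R by rewrite ler0n.
  by move: m0; nra.
by rewrite -ler_pdivlMl // ltW // mulrC.
Qed.

(** The extension of a vector that is negative at some [z > 1] has Rayleigh quotient above
    [z + z^-1] in a finite graph, hence [sg > z]; precision [z - 1] then leaves [s > 1]. *)
Lemma core_family_gt1 : 1 < s.
Proof.
have [z [v [z1 neg]]] := core_negative_gt1.
have z0 : 0 < z by rewrite (lt_trans _ z1).
have zn : `|z| = z by rewrite ger0_norm // ltW.
have z1' : 1 < `|z| by rewrite zn.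
pose q := - \sum_x v x * core_op a D z v x.
have q0 : 0 < q by rewrite oppr_gt0.
pose m := \sum_x `|v x|.
have m0 : 0 <= m by apply: sumr_ge0.
have m1 : 0 < m + 1 by rewrite ltr_wpDl.
have del0 : 0 < q / (m + 1) by rewrite divr_gt0.
have eps0 : 0 < z - 1 by rewrite subr_gt0.
have [sg [n [e [i [y [[sp sg1 cl] inj yE hy err]]]]]] := approx_extension v z1' eps0 del0.
have [sym_e lam2 _ spec] := sp.
have neg2 : \sum_u y u * ((z + z^-1) * y u - \sum_w adjacency R e u w * y w) < 0.
  rewrite (bigID (mem (codom i))) /= (big_core inj) [X in _ + X]big1 ?addr0; last first.
    by move=> u uC; rewrite adjacency_sum hy // subrr mulr0.
  apply: (@le_lt_trans _ _ (\sum_x (v x * core_op a D z v x + `|v x| * (q / (m + 1))))).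
    apply: ler_sum => x _; rewrite adjacency_sum yE.
    set T := (z + z^-1) * v x - _.
    have -> : v x * T = v x * core_op a D z v x + v x * (T - core_op a D z v x) by ring.
    rewrite lerD2l; apply: le_trans (ler_norm _) _; rewrite normrM ler_wpM2l //.
    exact: err.
  rewrite big_split /= -mulr_suml -/m.
  have : m * (q / (m + 1)) < q by rewrite mulrA ltr_pdivrMr // [ltRHS]mulrC ltr_pM2r //; lra.
  by rewrite {2}/q; lra.
have [x' [y' [xx' /graph_eigenE y'E]]] := eigenvalue_gt (adjacency_sym R sym_e) neg2.
have x2 : 2 < z + z^-1 by have := norm_add_inv_gt2 z1'; rewrite ger0_norm // addr_ge0 // ?invr_ge0 ltW.
have x'2 : 2 < `|x'| by rewrite (lt_le_trans _ (ler_norm _)) // (lt_trans x2).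
have lamx : sg + sg^-1 = x'.
  by case: (spec _ _ y'E x'2) => [->//|[_ x'E]]; move: x'E lam2 x2 xx'; lra.
have : z < sg by apply: add_inv_ltW => //; rewrite lamx.
by move: cl; rewrite ltr_norml => /andP[_ cl2]; lra.
Qed.

(** A kernel vector at [z] extends to approximate eigenvectors of the finite graphs for [z + z^-1].
    The true eigenvalue nearby exceeds 2 in modulus, so it is [lam] or, if [b], possibly [- lam],
    and [lam] is close to [s + s^-1]. *)
Lemma core_kernel_real (z : R) (v : 'I_c -> R) : 1 < `|z| ->
  (exists x, v x != 0) -> (forall x, core_op a D z v x = 0) -> z = s \/ (b /\ z = - s).
Proof.
move=> z1 [x0 vx0] ker; apply: contrapT => no.
pose L := s + s^-1; pose x := z + z^-1.
have s1 := core_family_gt1.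
have sn : `|s| = s by rewrite ger0_norm // ltW // (lt_trans _ s1).
have xL : x != L.
  by apply/eqP => E; apply: no; left; apply: add_inv_inj E; rewrite ?sn.
have xL' : b -> x != - L.
  move=> hb; apply/eqP => E; apply: no; right; split=> //; apply: add_inv_inj => //.
    by rewrite normrN sn.
  by rewrite -/x E /L invrN opprD.
have x2 := norm_add_inv_gt2 z1; rewrite -/x in x2.
(* [g] is at most the distance of [x] from [[-2, 2]], from [L] and, if [b], from [- L]; otherwise 1
   is a placeholder. Two errors of size [g / 3] cannot bridge it. *)
pose g := Num.min (`|x| - 2) (Num.min `|x - L| (if b then `|x + L| else 1)).
have g0 : 0 < g.
  rewrite !lt_min subr_gt0 x2 normr_gt0 subr_eq0 xL /=.
  by case: b xL' => [/(_ isT) h|_]; rewrite ?ltr01 // normr_gt0 addr_eq0.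
pose ep := g / 3.
have ep0 : 0 < ep by rewrite divr_gt0 // ltr0n.
have v20 : 0 < \sum_x v x ^+ 2.
  rewrite (bigD1 x0) //= ltr_wpDr ?exprn_even_gt0 // sumr_ge0 // => x' _; exact: sqr_ge0.
have cR0 : 0 < c%:R + 1 :> R by rewrite ltr_wpDl ?ler0n.
pose delta := Num.sqrt (ep ^+ 2 * (\sum_x v x ^+ 2) / (c%:R + 1)).
have dd0 : 0 < ep ^+ 2 * (\sum_x v x ^+ 2) / (c%:R + 1) by rewrite divr_gt0 // mulr_gt0 // exprn_gt0.
have delta0 : 0 < delta by rewrite sqrtr_gt0.
have delta2 : delta ^+ 2 = ep ^+ 2 * (\sum_x v x ^+ 2) / (c%:R + 1) by rewrite sqr_sqrtr // ltW.
have [sg [n [e [i [y [[sp sg1 cl] inj yE hy err]]]]]] := approx_extension v z1 ep0 delta0.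
have [sym_e lam2 _ spec] := sp.
have y0 : exists u, y u != 0 by exists (i x0); rewrite yE.
have resid : \sum_u (\sum_w adjacency R e u w * y w - x * y u) ^+ 2 <= ep ^+ 2 * \sum_u y u ^+ 2.
  rewrite (bigID (mem (codom i))) /= (big_core inj) [X in _ + X]big1 ?addr0; last first.
    by move=> u uC; rewrite adjacency_sum hy // subrr expr0n.
  apply: (@le_trans _ _ (ep ^+ 2 * \sum_x v x ^+ 2)); last first.
    rewrite ler_wpM2l ?sqr_ge0 // [leRHS](bigID (mem (codom i))) /= (big_core inj).
    rewrite (eq_bigr (fun x => y (i x) ^+ 2)) => [|x' _]; last by rewrite yE.
    by rewrite lerDl sumr_ge0 // => u _; exact: sqr_ge0.
  apply: (@le_trans _ _ (\sum_(x' < c) delta ^+ 2)).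
    apply: ler_sum => x' _; rewrite adjacency_sum yE.
    rewrite -sqrrN opprB -[leLHS]real_normK ?num_real // lerXn2r ?nnegrE ?(ltW delta0) //.
    by have := err x'; rewrite ker subr0.
  rewrite sumr_const card_ord -mulr_natl delta2 mulrCA ger_pMr.
    by rewrite ler_pdivrMr // mul1r lerDl.
  by apply: mulr_gt0 => //; exact: exprn_gt0.
have [x' [y' [xx' /graph_eigenE y'E]]] := eigenvalue_near (adjacency_sym R sym_e) y0 resid.
have xx : `|x' - x| <= ep.
  by rewrite -(@ler_pXn2r _ 2) ?nnegrE ?(ltW ep0) // real_normK ?num_real.
have LL : `|(sg + sg^-1) - L| <= ep.
  by apply: le_trans (add_inv_lipschitz (ltW sg1) (ltW s1)) (ltW cl).
have g3 : ep * 3 = g by rewrite /ep divfK // pnatr_eq0.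
have g1 : g <= `|x| - 2 by rewrite /g ge_min lexx.
have g2 : g <= `|x - L| by rewrite /g !ge_min lexx orbT.
have x'2 : 2 < `|x'|.
  have : `|x| <= `|x'| + `|x' - x| by rewrite -{1}(subKr x' x) ler_normB.
  by lra.
case: (spec _ _ y'E x'2) => [x'E|[hb x'E]].
  have : `|x - L| <= `|x' - x| + `|x' - L|.
    have -> : x - L = (x - x') + (x' - L) by ring.
    by rewrite -[`|x' - x|]normrN opprB ler_normD.
  by rewrite {2}x'E; lra.
have gb : g <= `|x + L| by rewrite /g hb !ge_min lexx !orbT.
have : `|x + L| <= `|x' - x| + `|x' + L|.
  have -> : x + L = (x - x') + (x' + L) by ring.
  by rewrite -[`|x' - x|]normrN opprB ler_normD.
have -> : `|x' + L| = `|(sg + sg^-1) - L| by rewrite x'E -normrN opprD opprK.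
by lra.
Qed.

(** Extended by 0, such a [v] is an exact eigenvector of a member of the family, since [D x]
    vanishes wherever [v] does not. Then [s + s^-1] is its [lam], so [sg = s], which the family
    excludes. *)
Lemma core_no_compact_eigen (v : 'I_c -> R) : (exists x, v x != 0) ->
  (forall x, \sum_(y | a x y) v y = (s + s^-1) * v x) ->
  (forall x, (D x)%:R * v x = 0) -> False.
Proof.
move=> [x0 vx0] vE vD.
have s1 := core_family_gt1.
have [sg [n [e [i [[[sym_e lam2 _ spec] sg1 /andP[ne _]] inj aE DE _]]]]] := fam 0 ltr01.
pose y u := if u \in codom i is true then odflt 0 (omap v [pick x | i x == u]) else 0.
have yE x : y (i x) = v x.
  rewrite /y codom_f; case: pickP => [x' /eqP/inj ->//|/(_ x)]; by rewrite eqxx.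
have yN u : u \notin codom i -> y u = 0 by rewrite /y => /negbTE ->.
have eig : graph_eigen e (s + s^-1) y.
  split; first by exists (i x0); rewrite yE.
  move=> u; have [/codomP[x ->]|uC] := boolP (u \in codom i).
    rewrite (sum_split_core inj aE) yE -vE [X in _ + X]big1 ?addr0 => [|w /andP[_]]; last exact: yN.
    by apply: eq_bigr => x' _; rewrite yE.
  rewrite yN // mulr0 big1 // => w uw.
  have [/codomP[x xE]|wC] := boolP (w \in codom i); last exact: yN.
  have /eqP := vD x; rewrite xE yE mulf_eq0 => /orP[|/eqP //].
  rewrite pnatr_eq0 -DE cards_eq0 => /eqP/setP/(_ u).
  by rewrite !inE uC andbT -xE sym_e uw.
have sn : `|s| = s by rewrite ger0_norm // ltW // (lt_trans _ s1).
have sgn : `|sg| = sg by rewrite ger0_norm // ltW // (lt_trans _ sg1).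
have L2 : 2 < `|s + s^-1| by apply: norm_add_inv_gt2; rewrite sn.
have s0 : 0 < s by rewrite (lt_trans _ s1).
have L0 : 0 < s + s^-1 by rewrite addr_gt0 // invr_gt0.
case: (spec _ _ eig L2) => [E|[_ E]]; last by move: E L0 lam2; lra.
have := add_inv_inj _ _ E; rewrite sn sgn => /(_ s1 sg1) sE.
by move: ne; rewrite sE subrr normr0 ltxx.
Qed.
End WithFamily.
End Limit.

(** * Singularity of the core operator at the limit *)

Section Singular.
Variable R : realType.
Variables (b : bool) (s : R) (c : nat) (a : rel 'I_c) (D : 'I_c -> nat).
Hypothesis fam : core_family b s a D.

Lemma core_op_diff (z w : R) (v : 'I_c -> R) x : 1 <= z -> 1 <= w ->
  `|core_op a D z v x - core_op a D w v x| <= `|z - w| * (1 + (D x)%:R) * `|v x|.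
Proof.
move=> z1 w1; have z0 : 0 < z by rewrite (lt_le_trans ltr01). have w0 : 0 < w by rewrite (lt_le_trans ltr01).
have -> : core_op a D z v x - core_op a D w v x =
    ((z + z^-1) - (w + w^-1)) * v x - (z^-1 - w^-1) * ((D x)%:R * v x).
  by rewrite /core_op; ring.
have inv : `|z^-1 - w^-1| <= `|z - w|.
  have -> : z^-1 - w^-1 = (w - z) * (z * w)^-1 by field; rewrite !gt_eqF.
  rewrite normrM -normrN opprB -[leRHS]mulr1 ler_wpM2l //.
  have zw1 : 1 <= z * w by rewrite mulr_ege1.
  by rewrite normfV ger0_norm ?invf_le1 ?(le_trans ler01) // (lt_le_trans ltr01).
apply: le_trans (ler_normB _ _) _; rewrite !normrM.
rewrite -mulrA mulrDl mul1r mulrDr lerD //.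
  by rewrite ler_wpM2r // add_inv_lipschitz.
by rewrite normr_nat ler_wpM2r // mulr_ge0.
Qed.

Definition core_mx (z : R) : 'M[R]_c :=
  \matrix_(x, y) ((z + z^-1 - z^-1 * (D x)%:R) * (y == x)%:R - (a x y)%:R).

Lemma core_mxE z (v : 'I_c -> R) x : (core_mx z *m \col_y v y) x 0 = core_op a D z v x.
Proof.
transitivity ((z + z^-1 - z^-1 * (D x)%:R) * v x - \sum_(y | a x y) v y); last by rewrite /core_op; ring.
rewrite big_mkcond /= -[in RHS](sum_delta v x) mulr_sumr -sumrB mxE.
by apply: eq_bigr => y _; rewrite !mxE; case: (a x y); rewrite /=; ring.
Qed.

(** The core operator at [s] almost kills the restricted eigenvectors of [lam]. Were it invertible,
    their size [m] would satisfy [m < m] unless it is 0, and then the maximum principle kills the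
    whole eigenvector. *)
Lemma core_singular : exists v : 'I_c -> R, (exists x, v x != 0) /\ forall x, core_op a D s v x = 0.
Proof.
have [/det0P[v v0 vN]|det] := boolP (\det (core_mx s)^T == 0).
  exists (v 0); split; first exact/rV0Pn.
  move=> x; rewrite -core_mxE; have -> : \col_y v 0 y = v^T.
    by apply/matrixP => y k; rewrite !mxE (ord1 k).
  by rewrite -[core_mx s]trmxK -trmx_mul vN !mxE.
exfalso.
have s1 := core_family_gt1 fam.
have Nu : core_mx s \in unitmx by rewrite unitmxE -det_tr unitfE.
pose P := invmx (core_mx s).
have PE v x : v x = \sum_y P x y * core_op a D s v y.
  have : \col_y v y = P *m (core_mx s *m \col_y v y) by rewrite mulKmx.
  move=> /matrixP/(_ x 0); rewrite [LHS]mxE => ->; rewrite mxE.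
  by apply: eq_bigr => y _; rewrite core_mxE.
pose ka := \sum_x \sum_y `|P x y|.
have ka0 : 0 <= ka by apply: sumr_ge0 => x _; apply: sumr_ge0.
pose W := 1 + \sum_x (D x)%:R : R.
have DW x : 1 + (D x)%:R <= W by rewrite lerD2l (D_le_sum R).
have W0 : 0 <= W by rewrite addr_ge0 // sumr_ge0 // => x _; rewrite ler0n.
(* [ka] bounds the inverse and [W] the Lipschitz constants, so an error factor below [de] is
   absorbed: [ka * W * de < 1]. *)
pose de := (ka * W + 1)^-1.
have kW0 : 0 <= ka * W by rewrite mulr_ge0.
have de0 : 0 < de by rewrite invr_gt0 ltr_wpDl.
(* A radius strictly between 1 and [s] makes the decay rate uniform over all [sg >= r]. *)
pose r := (1 + s) / 2.
have r1 : 1 < r by rewrite /r; lra.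
have rs : r < s by rewrite /r; lra.
have [K KP] := exp_small r1 (divr_gt0 de0 (ltr0n R 4)).
pose ep := Num.min (s - r) (de / 2).
have ep0 : 0 < ep by rewrite lt_min subr_gt0 rs divr_gt0.
have [sg [n [e [i [[[sym_e lam2 [y [[u0 yu0] yE]] _] sg1 /andP[_ cl]] inj aE DE [d2 w]]]]]] := fam K ep0.
pose v := y \o i; pose m := \sum_x `|v x|.
have m0 : 0 <= m by apply: sumr_ge0.
have sgr : r <= sg.
  have : ep <= s - r by rewrite ge_min lexx.
  by move: cl; rewrite ltr_norml => /andP[h _]; lra.
have sgn : `|sg| = sg by rewrite ger0_norm // ltW // (lt_trans ltr01).
have sg1' : 1 < `|sg| by rewrite sgn.
have hy : harmonic e [set i x | x : 'I_c] sg y by move=> p _; exact: yE.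
have ym x : `|y (i x)| <= m by exact: (ler_sum_norm v x).
have sgK : 0 <= `|sg| ^- K by rewrite invr_ge0 exprn_ge0.
have small x : `|core_op a D s v x| <= W * m * (2 * `|sg| ^- K + ep).
  have h1 := core_residual inj aE DE x d2 w sg1' m0 hy ym.
  rewrite yE subrr sub0r normrN in h1.
  have h2 := @core_op_diff s sg v x (ltW s1) (ltW sg1).
  have h3 : `|core_op a D s v x| <= `|core_op a D sg v x| + `|core_op a D s v x - core_op a D sg v x|.
    by apply: le_trans (ler_normD _ _); rewrite addrC subrK.
  apply: le_trans h3 _; rewrite mulrDr lerD //.
    apply: le_trans h1 _; rewrite -/v; have -> : W * m * (2 * `|sg| ^- K) = W * (2 * m * `|sg| ^- K) by ring.
    by rewrite ler_wpM2r ?mulr_ge0 //; apply: le_trans (DW x); rewrite lerDr.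
  apply: le_trans h2 _; rewrite [leRHS]mulrC mulrA.
  have dm : `|s - sg| <= ep by rewrite -normrN opprB ltW.
  apply: ler_pM => //; last exact: ym.
    by rewrite mulr_ge0 // addr_ge0 // ler0n.
  by apply: ler_pM => //; rewrite addr_ge0 // ler0n.
have mle : m <= ka * (W * m * (2 * `|sg| ^- K + ep)).
  rewrite /m {1}(eq_bigr (fun x => `|\sum_y P x y * core_op a D s v y|)) => [|x _]; last by rewrite -PE.
  rewrite -/m /ka mulr_suml; apply: ler_sum => x _.
  apply: le_trans (ler_norm_sum _ _ _) _; rewrite mulr_suml; apply: ler_sum => y' _.
  by rewrite normrM ler_wpM2l.
have tiny : 2 * `|sg| ^- K + ep < de.
  have : `|sg| ^- K < de / 4 by rewrite sgn; exact: KP.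
  have : ep <= de / 2 by rewrite ge_min lexx orbT.
  by lra.
have mz : m = 0.
  apply/eqP; rewrite eq_le m0 andbT leNgt; apply/negP => mp.
  have h4 : ka * (W * m * (2 * `|sg| ^- K + ep)) <= (ka * W * de) * m.
    have -> : ka * (W * m * (2 * `|sg| ^- K + ep)) = (ka * W * m) * (2 * `|sg| ^- K + ep) by ring.
    have -> : ka * W * de * m = (ka * W * m) * de by ring.
    by rewrite ler_wpM2l ?mulr_ge0 // ltW.
  have : ka * W * de < 1 by rewrite /de ltr_pdivrMr ?mul1r ?ltrDl // ltr_wpDl.
  move=> h5; have : (ka * W * de) * m < m by rewrite gtr_pMl.
  by lra.
have CE := mem_imset_codom i.
have d2' u : u \notin [set i x | x : 'I_c] -> (deg e u <= 2)%N by rewrite CE; exact: d2.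
have : `|y u0| <= 0.
  apply: (harmonic_max d2' sg1' (lexx _) hy) => u; rewrite CE => /codomP[x ->].
  by rewrite -mz.
by rewrite normr_le0 (negbTE yu0).
Qed.
End Singular.

(** * Integer polynomials attached to the core *)

(** With the core adjacency for [A] and the diagonal matrix of [D] for [B], this is the kernel of
    [z] times the core operator; clearing [z^-1] gives integer coefficients. *)
Definition pencil_ker (K : fieldType) c (A B : 'M[K]_c) (z : K) (v : 'rV[K]_c) : Prop :=
  v *m B + z *: (v *m A) = (z ^+ 2 + 1) *: v.

(* Linearisation of the quadratic pencil [(z^2 + 1) - z A - B]. *)
Definition pencil_mx (K : pzRingType) c (A B : 'M[K]_c) : 'M[K]_(c + c) :=
  block_mx A (B - 1%:M) 1%:M 0.

(** The row eigenvectors of the linearisation are the pairs [(v, z v - v A)]. *)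
Lemma root_pencil (K : fieldType) c (A B : 'M[K]_c) (z : K) :
  root (char_poly (pencil_mx A B)) z <-> exists v : 'rV[K]_c, v != 0 /\ pencil_ker A B z v.
Proof.
rewrite -eigenvalue_root_char; split.
  move=> /eigenvalueP[w]; rewrite -[w]hsubmxK.
  move: (lsubmx w) (rsubmx w) => v u; rewrite mul_row_block scale_row_mx mulmx1 mulmx0 addr0.
  move=> /eq_row_mx[E1 E2] w0.
  have uE : u = z *: v - v *m A by rewrite -E1 addrC addKr.
  exists v; split.
    apply: contraNneq w0 => v0; rewrite uE v0 mul0mx scaler0 subr0.
    by rewrite row_mx0.
  rewrite /pencil_ker; move: E2; rewrite mulmxBr mulmx1 uE scalerBr scalerA -expr2.
  move=> /(canRL (subrK _)) ->.
  by rewrite scalerDl scale1r addrAC subrK.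
move=> [v [v0 vE]]; apply/eigenvalueP; exists (row_mx v (z *: v - v *m A)).
  rewrite mul_row_block scale_row_mx mulmx1 mulmx0 addr0 addrC subrK.
  rewrite mulmxBr mulmx1 scalerBr scalerA -expr2; congr (row_mx _ _).
  have -> : v *m B = (z ^+ 2 + 1) *: v - z *: (v *m A) by rewrite -vE addrK.
  by rewrite scalerDl scale1r addrAC addrK.
by apply: contra v0 => /eqP E; apply/eqP; have := congr1 lsubmx E; rewrite row_mxKl linear0.
Qed.

(** Pairing with the conjugate of [v] gives [(z^2 + 1) nu = z al + de] with [nu > 0], [al] real and
    [de >= 0]. Eliminating [al] against the conjugate equation yields [key]; for nonreal [z] of
    modulus at least 1 it forces [de = 0], so [B] kills [v]. *)
Lemma complex_pencil_ker (R : rcfType) c (A B : 'M[R]_c) (z : R[i]) (v : 'rV[R[i]]_c) :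
  A^T = A -> is_diag_mx B -> (forall x, 0 <= B x x) ->
  v != 0 -> 1 <= `|z| -> pencil_ker (map_mx (real_complex R) A) (map_mx (real_complex R) B) z v ->
  (exists r, z = r%:C%C) \/
  (v *m map_mx (real_complex R) B = 0 /\ z *: (v *m map_mx (real_complex R) A) = (z ^+ 2 + 1) *: v).
Proof.
move=> sA dB B0 v0 z1 ker.
set AC := map_mx _ A in ker *; set BC := map_mx _ B in ker *.
have conjR (r : R) : (r%:C%C)^* = r%:C%C by apply/CrealP/complex_realP; exists r.
have BCE (w : 'rV[R[i]]_c) x : (w *m BC) 0 x = (B x x)%:C%C * w 0 x.
  rewrite mxE (bigD1 x) //= big1 ?addr0 => [|y yx]; first by rewrite mxE mulrC.
  by rewrite mxE (is_diag_mxP dB) ?mulr0.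
pose nu := \sum_x `|v 0 x| ^+ 2.
pose al := \sum_x (v *m AC) 0 x * (v 0 x)^*.
pose de := \sum_x (B x x)%:C%C * `|v 0 x| ^+ 2.
have E : de + z * al = (z ^+ 2 + 1) * nu.
  rewrite /de /al /nu !mulr_sumr -big_split; apply: eq_bigr => x _ /=.
  have := congr1 (fun w : 'rV_c => w 0 x) ker.
  rewrite mxE BCE [X in _ + X = _]mxE [RHS]mxE => Ex.
  by rewrite normCK !mulrA -Ex; ring.
have ACE x : (v *m AC) 0 x = \sum_y v 0 y * (A y x)%:C%C.
  by rewrite mxE; apply: eq_bigr => y _; rewrite mxE.
have alR : al^* = al.
  have -> : al = \sum_x \sum_y v 0 y * (A y x)%:C%C * (v 0 x)^*.
    by apply: eq_bigr => x _; rewrite ACE mulr_suml.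
  rewrite rmorph_sum [RHS]exchange_big; apply: eq_bigr => x _.
  rewrite rmorph_sum; apply: eq_bigr => y _ /=.
  rewrite !rmorphM /= conjCK conjR.
  have -> : A y x = A x y by rewrite -{1}sA mxE.
  ring.
have nuR : nu^* = nu.
  by apply/CrealP; apply: sum_real => x _; rewrite rpredX // normr_real.
have deR : de^* = de.
  apply/CrealP; apply: sum_real => x _; rewrite rpredM ?rpredX ?normr_real //.
  by apply/complex_realP; exists (B x x).
have de0 : 0 <= de by apply: sumr_ge0 => x _; rewrite mulr_ge0 ?exprn_ge0 // ler0c.
have nu0 : 0 < nu.
  have /rV0Pn[x vx] := v0.
  rewrite /nu (bigD1 x) //= ltr_wpDr ?exprn_gt0 ?normr_gt0 //.
  by rewrite sumr_ge0 // => y _; rewrite exprn_ge0.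
have key : (z - z^*) * ((z * z^* - 1) * nu + de) = 0.
  have Ec : de + z^* * al = ((z^*) ^+ 2 + 1) * nu.
    by have := congr1 Num.conj E; rewrite !(rmorphD, rmorphM, rmorphXn, rmorph1) /= alR nuR deR.
  have : z^* * (de + z * al) - z * (de + z^* * al) = z^* * ((z ^+ 2 + 1) * nu) - z * (((z^*) ^+ 2 + 1) * nu).
    by rewrite E Ec.
  move=> h; apply/eqP; rewrite -subr_eq0; apply/eqP; move/eqP: h; rewrite -subr_eq0 => /eqP h.
  by rewrite -[RHS]oppr0 -[in RHS]h; ring.
have /eqP := key; rewrite mulf_eq0 => /orP[|/eqP h].
  rewrite subr_eq0 eq_sym => /eqP zR; left; apply/complex_realP; exact/CrealP.
right.
have d0 : de = 0.
  apply/eqP; rewrite eq_le de0 andbT -h lerDr mulr_ge0 ?(ltW nu0) //.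
  by rewrite -normCK subr_ge0 exprn_ege1.
have vB : v *m BC = 0.
  apply/rowP => x; rewrite BCE [RHS]mxE.
  have : de == 0 by rewrite d0.
  rewrite psumr_eq0 => [|y _]; last by rewrite mulr_ge0 ?exprn_ge0 // ler0c.
  move=> /allP/(_ x (mem_index_enum x)) /=.
  by rewrite mulf_eq0 expf_eq0 normr_eq0 /= => /orP[/eqP ->|/eqP ->]; rewrite ?mul0r ?mulr0.
by split=> //; move: ker; rewrite /pencil_ker vB add0r.
Qed.

Section Compact.
Variables (c : nat) (A B : 'M[int]_c).

(* A polynomial whose roots detect common solutions of [z (v A) = (z^2 + 1) v] and [v B = 0]. *)
Definition compact_poly : {poly int} :=
  let E := ('X^2 + 1)%:M - 'X *: map_mx polyC A in
  \det (E *m E + 'X^2 *: (map_mx polyC B *m map_mx polyC B)).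

Definition compact_mx (K : numFieldType) (z : K) : 'M[K]_c :=
  (z ^+ 2 + 1)%:M - z *: map_mx intr A.

Lemma compact_poly_eval (K : numFieldType) (z : K) :
  (intp K compact_poly).[z] =
    \det (compact_mx z *m compact_mx z + z ^+ 2 *: (map_mx intr B *m map_mx intr B)).
Proof.
pose phi : {rmorphism {poly int} -> K} := horner_eval z \o map_poly (intr : int -> K).
have phiX : phi 'X = z by rewrite /phi /= map_polyX /horner_eval hornerX.
have phiX2 : phi 'X^2 = z ^+ 2 by rewrite rmorphXn phiX.
have phiE : phi ('X^2 + 1) = z ^+ 2 + 1 by rewrite rmorphD rmorph1 phiX2.
have phiM (M : 'M[int]_c) : map_mx phi (map_mx polyC M) = map_mx intr M.
  by apply/matrixP => x y; rewrite !mxE /= map_polyC /horner_eval hornerC.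
have -> : (intp K compact_poly).[z] = phi compact_poly by [].
rewrite /compact_poly -det_map_mx.
rewrite map_mxD map_mxM map_mxZ map_mxM !phiM map_mxB map_scalar_mx map_mxZ !phiM.
by rewrite phiE phiX2 phiX.
Qed.

Lemma compact_poly_root (K : numFieldType) (z : K) (v : 'rV[K]_c) : v != 0 ->
  v *m map_mx intr B = 0 -> z *: (v *m map_mx intr A) = (z ^+ 2 + 1) *: v ->
  root (intp K compact_poly) z.
Proof.
move=> v0 vB vA; rewrite /root compact_poly_eval; apply/det0P; exists v => //.
have vE : v *m compact_mx z = 0.
  by rewrite mulmxBr mul_mx_scalar -scalemxAr vA subrr.
by rewrite mulmxDr mulmxA vE mul0mx add0r -scalemxAr mulmxA vB mul0mx scaler0.
Qed.

Lemma row_sqr_eq0 (K : realFieldType) n (u : 'rV[K]_n) : (u *m u^T) 0 0 <= 0 -> u = 0.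
Proof.
rewrite mxE => h; apply/rowP => x; rewrite mxE.
have : \sum_j u 0 j ^+ 2 == 0.
  rewrite eq_le sumr_ge0 ?andbT => [|j _]; last exact: sqr_ge0.
  by move: h; rewrite (eq_bigr (fun j => u 0 j ^+ 2)) // => j _; rewrite mxE.
rewrite psumr_eq0 => [|j _]; last exact: sqr_ge0.
by move=> /allP/(_ x (mem_index_enum x)); rewrite /= sqrf_eq0 => /eqP.
Qed.

(** For real [z] the matrix under the determinant is a sum of squares of symmetric matrices, so a
    null vector is killed by each of them; hence the squares in [compact_poly]. *)
Lemma compact_poly_root_real (K : realFieldType) (z : K) : A^T = A -> B^T = B -> z != 0 ->
  root (intp K compact_poly) z -> exists v : 'rV[K]_c, [/\ v != 0,
    v *m map_mx intr B = 0 & z *: (v *m map_mx intr A) = (z ^+ 2 + 1) *: v].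
Proof.
move=> sA sB z0; rewrite /root compact_poly_eval => /det0P[v v0 vM].
set AK := map_mx intr A in vM *; set BK := map_mx intr B in vM *.
have sAK : AK^T = AK by apply/matrixP => x y; rewrite !mxE -{1}sA mxE.
have sBK : BK^T = BK by apply/matrixP => x y; rewrite !mxE -{1}sB mxE.
have sE : (compact_mx z)^T = compact_mx z.
  by rewrite /compact_mx linearB /= tr_scalar_mx linearZ /= -/AK sAK.
have E : ((v *m compact_mx z) *m (v *m compact_mx z)^T) 0 0 +
     z ^+ 2 * ((v *m BK) *m (v *m BK)^T) 0 0 = 0.
  have e1 : v *m compact_mx z *m (v *m compact_mx z)^T = v *m (compact_mx z *m compact_mx z) *m v^T.
    by rewrite trmx_mul sE !mulmxA.
  have e2 : v *m BK *m (v *m BK)^T = v *m (BK *m BK) *m v^T by rewrite trmx_mul sBK !mulmxA.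
  rewrite e1 e2; have : (v *m (compact_mx z *m compact_mx z) *m v^T + z ^+ 2 *: (v *m (BK *m BK) *m v^T)) 0 0 = 0.
    by rewrite scalemxAl scalemxAr -mulmxDl -mulmxDr vM mul0mx mxE.
  have entry (M N : 'M[K]_1) k : (M + k *: N) 0 0 = M 0 0 + k * N 0 0 by rewrite !mxE.
  by rewrite entry.
have pos (u : 'rV[K]_c) : 0 <= (u *m u^T) 0 0.
  by rewrite mxE sumr_ge0 // => j _; rewrite mxE -expr2 sqr_ge0.
have z2 : 0 < z ^+ 2 by rewrite exprn_even_gt0.
have h1 := pos (v *m compact_mx z); have h2 := pos (v *m BK).
have h3 : 0 <= z ^+ 2 * ((v *m BK) *m (v *m BK)^T) 0 0 by rewrite mulr_ge0 // ltW.
exists v; split=> //.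
  by apply: row_sqr_eq0; rewrite -(pmulr_rle0 _ z2); lra.
have : v *m compact_mx z = 0 by apply: row_sqr_eq0; lra.
rewrite mulmxBr mul_mx_scalar -scalemxAr => /eqP; rewrite subr_eq0 => /eqP ->.
by [].
Qed.
End Compact.

(** * The limit of a core family is a Pisot number *)

Section Final.
Variable R : realType.

Lemma core_family_pisot b (s : R) c (a : rel 'I_c) (D : 'I_c -> nat) :
  core_family b s a D -> pisot (if b then s ^+ 2 else s).
Proof.
move=> fam; have s1 := core_family_gt1 fam; have sym_a := core_family_symmetric fam.
have s0 : s != 0 by rewrite gt_eqF // (lt_trans ltr01).
pose A : 'M[int]_c := \matrix_(x, y) (a x y)%:R.
pose B : 'M[int]_c := diag_mx (\row_x (D x)%:R).
have sA : A^T = A by apply/matrixP => x y; rewrite !mxE sym_a.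
have sB : B^T = B by rewrite tr_diag_mx.
pose AK (K : numFieldType) : 'M[K]_c := map_mx intr A.
pose BK (K : numFieldType) : 'M[K]_c := map_mx intr B.
have FE (K : numFieldType) : intp K (char_poly (pencil_mx A B)) = char_poly (pencil_mx (AK K) (BK K)).
  by rewrite intp_char_poly /pencil_mx map_block_mx map_mxB map_mx1 map_mx0.
have vAE (v : 'rV[R]_c) x : (v *m AK R) 0 x = \sum_(y | a x y) v 0 y.
  rewrite mxE [RHS]big_mkcond; apply: eq_bigr => y _; rewrite !mxE sym_a.
  by case: (a x y); rewrite ?mulr1 ?mulr0.
have vBE (v : 'rV[R]_c) x : (v *m BK R) 0 x = (D x)%:R * v 0 x.
  rewrite /BK map_diag_mx mul_mx_diag !mxE mulrC; congr (_ * _).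
  by rewrite rmorph_nat.
have kerE (z : R) (v : 'rV[R]_c) : z != 0 ->
    pencil_ker (AK R) (BK R) z v <-> forall x, core_op a D z (v 0) x = 0.
  move=> z0.
  have E x : (v *m BK R + z *: (v *m AK R)) 0 x - ((z ^+ 2 + 1) *: v) 0 x = - z * core_op a D z (v 0) x.
    by rewrite mxE vBE [(z *: _ : 'rV_c) 0 x]mxE vAE [(_ *: v) 0 x]mxE /core_op; field.
  split=> [ker x|ker].
    apply: (mulfI (_ : - z != 0)); first by rewrite oppr_eq0.
    by rewrite -E ker subrr mulr0.
  by apply/rowP => x; apply/eqP; rewrite -subr_eq0 E ker mulr0.
apply: (@pisot_criterion _ b s (char_poly (pencil_mx A B)) (compact_poly A B) s1 (char_poly_monic _)).
- rewrite FE; apply/root_pencil.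
  have [v [[x vx] ker]] := core_singular fam.
  exists (\row_x v x); split.
    by apply: contraNneq vx => /rowP/(_ x); rewrite !mxE => ->.
  apply/(kerE _ _ s0) => y; rewrite -(ker y) /core_op !mxE; congr (_ - _ - _).
  by apply: eq_bigr => y' _; rewrite mxE.
(* A zero of [compact_poly] at [s] would give an eigenvector of the core killed by [D]. *)
- apply/negP => /(compact_poly_root_real sA sB s0)[v [v0 vB vA]].
  apply: (core_no_compact_eigen fam (rV0Pn v v0)) => x.
    rewrite -vAE; have /rowP/(_ x) := vA; rewrite [LHS]mxE [RHS]mxE => h.
    by apply: (mulfI s0); rewrite h; field.
  by rewrite -vBE vB mxE.
move=> z Fz z1.
have ACE : AK R[i] = map_mx (real_complex R) (AK R).
  by apply/matrixP => x y; rewrite !mxE rmorph_int.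
have BCE : BK R[i] = map_mx (real_complex R) (BK R).
  by apply/matrixP => x y; rewrite !mxE rmorph_int.
have := Fz; rewrite FE => /root_pencil[v [v0 ker]].
have sAR : (AK R)^T = AK R by apply/matrixP => x y; rewrite !mxE sym_a.
have dB : is_diag_mx (BK R) by rewrite /BK map_diag_mx diag_mx_is_diag.
have B0 x : 0 <= BK R x x by rewrite !mxE eqxx mulr1n rmorph_nat ler0n.
rewrite ACE BCE in ker.
(* A nonreal [z] is a root of [compact_poly]; a real one of modulus above 1 falls under
   [core_kernel_real], and only 1 and -1 remain. *)
case: (complex_pencil_ker sAR dB B0 v0 z1 ker) => [[r zr]|[vB vA]]; last first.
  rewrite -BCE in vB; rewrite -ACE in vA.
  by apply: Or44; exact: compact_poly_root v0 vB vA.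
have r1 : 1 <= `|r|.
  move: z1; rewrite zr normc_def /= expr0n /= addr0 sqrtr_sqr.
  by rewrite -[1]/((1%:C)%C : R[i]) lecR.
have [r1'|] := ltP 1 `|r|; last first.
  move=> r1''; apply: Or43.
  have : `|r| = 1 by apply/eqP; rewrite eq_le r1 r1''.
  have [rp|rn] := leP 0 r; first by rewrite ger0_norm // => rE; left; rewrite zr rE.
  rewrite ltr0_norm // => /(canRL (@opprK _)) rE; right.
  by rewrite zr rE rmorphN.
have r0 : r != 0 by rewrite -normr_gt0 (lt_trans ltr01).
have : root (intp R (char_poly (pencil_mx A B))) r by rewrite -root_intp_real -zr.
rewrite FE => /root_pencil[w [w0 /(kerE _ _ r0) kerw]].
case: (core_kernel_real fam r1' (rV0Pn w w0) kerw) => [rE|[hb rE]].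
  by apply: Or41; rewrite zr rE.
by apply: Or42; split=> //; rewrite zr rE rmorphN.
Qed.

(** * Limit points *)

Lemma salem_limit_pisot (b : bool) (s B : R) :
  (forall eps, 0 < eps -> exists sg n (e : rel 'I_n),
    [/\ salem_spectrum e b (sg + sg^-1), simple_eigen e (sg + sg^-1), irreflexive e,
        1 < sg <= B & 0 < `|sg - s| < eps]) ->
  pisot (if b then s ^+ 2 else s).
Proof.
move=> H.
(* [sg + sg^-1] is at most [B + 1], and [d] bounds its square, hence all degrees. *)
pose d := (Num.trunc ((B + 1) ^+ 2)).+1.
have [N core] := @salem_core_exists R d.
have H' eps : 0 < eps -> exists sg n (e : rel 'I_n) C,
    [/\ sample b s d eps sg e C, (#|C| <= N)%N & (#|boundary e C| <= N * d)%N].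
  move=> eps0; have [sg [n [e [sp simp irr /andP[sg1 sgB] cl]]]] := H eps eps0.
  have [e' [sp' simp' conn' sub]] := salem_spectrum_component sp simp.
  have irr' : irreflexive e' by move=> u; apply/negP => /sub; rewrite irr.
  have sg0 : 0 < sg by rewrite (lt_trans ltr01).
  have lamd : (sg + sg^-1) ^+ 2 <= d%:R.
    apply: ltW; apply: le_lt_trans (truncnS_gt _); rewrite lerXn2r ?nnegrE //.
    - by rewrite addr_ge0 // ?invr_ge0 ltW.
    - by rewrite addr_ge0 // ltW // (lt_le_trans sg0).
    - by rewrite lerD // invf_le1 // ltW.
  have dle := salem_deg_le sp' lamd.
  have [C [CN d2]] := core _ _ _ _ sp' simp' conn' lamd.
  exists sg, n, e', C; split=> //.
  by apply: leq_trans (card_boundary_le C dle) _; rewrite leq_mul2r CN orbT.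
have [N' walks] := long_walks H'.
have [c [a [D fam]]] := exists_core_family walks.
exact: core_family_pisot fam.
Qed.

(** Being the larger solution, [t] is at least its inverse, and [lam > 2] excludes equality; so
    [sg], which is [t] or its square root, exceeds 1. *)
Lemma T_graph_spectrum (t : R) : T_graph t -> exists (b : bool) (sg : R) n (e : rel 'I_n),
  [/\ 1 < sg, t = if b then sg ^+ 2 else sg, irreflexive e,
    salem_spectrum e b (sg + sg^-1) & simple_eigen e (sg + sg^-1)].
Proof.
move=> [n [e [lam [simple salem _ [nonbip bip]]]]].
have [[lam2 _] _ _ _ _] := salem.
have [_ irr] := simple.
have gt1 (sg : R) : sg + sg^-1 = lam -> sg^-1 <= sg -> 1 < sg.
  move=> sgE inv; have sg0 : 0 < sg.
    rewrite ltNge; apply/negP => sg0.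
    have : sg^-1 <= 0 by rewrite invr_le0.
    by move: lam2; rewrite -sgE; lra.
  rewrite ltNge; apply/negP => sg1.
  have : 1 <= sg^-1 by rewrite -invr1 lef_pV2 ?posrE.
  move=> h; have sgE1 : sg = 1 by apply/eqP; rewrite eq_le sg1 (le_trans h).
  by move: lam2; rewrite -sgE sgE1 invr1; lra.
have [bipe|nb] := pselect (bipartite e).
  have [sp simp] := salem_graph_spectrum simple salem (b := true) (conj (fun=> isT) (fun=> bipe)).
  have [t0 [tE tmax]] := bip bipe.
  exists true, (Num.sqrt t), n, e; rewrite tE sqr_sqrtr //; split=> //.
  apply: gt1 => //; rewrite -sqrtrV // ler_sqrt //; apply: tmax; first by rewrite invr_ge0.
  by rewrite sqrtrV // invrK addrC.
have [sp simp] := salem_graph_spectrum simple salem (b := false)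
  (conj (fun h => False_ind _ (nb h)) (fun h : false => match notF h with end)).
have [tE tmax] := nonbip nb.
exists false, t, n, e; rewrite tE; split=> //.
by apply: gt1 => //; apply: tmax; rewrite invrK addrC.
Qed.

(** By the pigeonhole principle one type, bipartite or not, occurs at every precision. In the
    bipartite case [t - x = (sg - Num.sqrt x) * (sg + Num.sqrt x)] with last factor at least 1, so
    the square roots converge too. *)
Lemma limit_point_T_graph_pisot (x : R) : limit_point (@T_graph R) x -> pisot x.
Proof.
move=> lim.
have close eps : 0 < eps -> exists t, [/\ T_graph t, t != x & `|t - x| < eps].
  move=> eps0; have [t [tx Tt bt]] := lim _ (nbhsx_ballx x eps eps0).
  by exists t; split=> //; rewrite distrC.
have x1 : 1 <= x.
  rewrite leNgt; apply/negP => x1; have eps0 : 0 < 1 - x by rewrite subr_gt0.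
  have [t [/T_graph_spectrum[b [sg [n [e [sg1 tE _ _ _]]]]] _]] := close _ eps0.
  have t1 : 1 < t by rewrite tE; case: b {tE} => //; rewrite exprn_egt1.
  by rewrite ltr_norml => /andP[_]; lra.
have x0 : 0 <= x by rewrite (le_trans ler01).
pose root_of (b : bool) := if b then Num.sqrt x else x.
pose P (b : bool) (m : nat) := exists sg n (e : rel 'I_n),
  [/\ salem_spectrum e b (sg + sg^-1), simple_eigen e (sg + sg^-1), irreflexive e,
      1 < sg <= x + 1 & 0 < `|sg - root_of b| < m.+1%:R^-1].
have [|m|b Pb] := @pigeonhole bool P.
- move=> b m m' mm [sg [n [e [sp simp irr sgB /andP[ne cl]]]]].
  exists sg, n, e; split=> //; rewrite ne (lt_le_trans cl) //.
  by rewrite lef_pV2 ?posrE ?ltr0n // ler_nat.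
- have eps0 : 0 < m.+1%:R^-1 :> R by rewrite invr_gt0 ltr0n.
  have [t [/T_graph_spectrum[b [sg [n [e [sg1 tE irr sp simp]]]]] tx tcl]] := close _ eps0.
  have epsle : m.+1%:R^-1 <= 1 :> R by rewrite invf_le1 ?ltr0n // ler1n.
  have tB : t <= x + 1 by have := lt_le_trans tcl epsle; rewrite ltr_norml => /andP[_]; lra.
  have sg0 : 0 <= sg by rewrite ltW // (lt_trans ltr01).
  exists b, sg, n, e; split=> //.
    rewrite sg1 /=; apply: le_trans tB; rewrite tE; case: b {sp tE} => //.
    by rewrite expr2 ler_peMr // ltW.
  rewrite normr_gt0 subr_eq0 /root_of.
  case: b {sp} tE => tE; last by rewrite -tE tx.
  have sx : Num.sqrt x ^+ 2 = x by rewrite sqr_sqrtr.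
  apply/andP; split; first by apply: contraNneq tx => E; rewrite tE E sx.
  apply: le_lt_trans tcl; rewrite tE -{2}sx subr_sqr normrM ler_peMr //.
  have := sqrtr_ge0 x => q0.
  by rewrite ger0_norm ?addr_ge0 //; lra.
have -> : x = if b then root_of b ^+ 2 else root_of b.
  by rewrite /root_of; case: b {Pb} => //; rewrite sqr_sqrtr.
apply: (@salem_limit_pisot _ _ (x + 1)) => eps eps0.
have [sg [n [e [sp simp irr sgB /andP[ne cl]]]]] := Pb (Num.trunc eps^-1).
exists sg, n, e; split=> //; rewrite ne (lt_le_trans cl) //.
rewrite -[leRHS]invrK lef_pV2 ?posrE ?invr_gt0 ?ltr0n //.
exact: ltW (truncnS_gt _).
Qed.
End Final.

Local Open Scope classical_set_scope.
Unset Implicit Arguments.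

(* S_graph := limit_point (@T_graph R) *)
Theorem theorem1 (R : realType) :
  (forall x : R, limit_point (@T_graph R) x -> pisot x) /\
  closed (@T_graph R `|` limit_point (@T_graph R)).
Proof.
split; first exact: limit_point_T_graph_pisot.
(* The closure splits into isolated points, which belong to the set, and limit points. *)
suff -> : @T_graph R `|` limit_point (@T_graph R) = closure (@T_graph R) by exact: closed_closure.
apply/seteqP; split=> x.
  by case; [exact: subset_closure|exact: subset_limit_point].
by rewrite closure_isolated_limit_point => -[/isolatedS|]; [left|right].
Qed.
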